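(* Let $x_0\in\mathbb R\setminus\{0\}$, let $a\in L^1_{\mathsf{loc}}(0,\infty)$, let $f:\mathbb R\times\mathbb R\to\mathbb R$ be differentiable in its second variable $x$, and let $X_h$ be the Milstein approximation defined in the context. Assume: (1) $\limsup_{t\to\infty}\frac1t\int_0^t a(s)\,ds$ is finite; (2) there exists $h_0>0$ such that for all $0<h<h_0$, with $t_k=kh$ and $\Delta A_k=\int_{t_k}^{t_{k+1}}a(s)\,ds$, one has $\gamma_*:=\inf_{k\ge 0}\Delta A_k>-\frac12$ and $\sup_{k\ge0}\Delta A_k<+\infty$; (3) there exist positive constants $f_*,f^*$ such that for all $x\in\mathbb R\setminus\{0\}$ and $t\in\mathbb R$, $$f_*\le\frac{f(t,x)}{x}\le f^*,\qquad \max\Big\{\frac12,\frac{2}{3+2\gamma_*}\Big\}\le\frac{x\,\partial_xf(t,x)}{f(t,x)},$$ and $\frac{x\,\partial_xf(t,x)}{f(t,x)}$ is bounded above uniformly in $(t,x)$. Then for any $0<p<1$ there exists $0<h^*<1$ such that for all $0<h<h^*$, $$\limsup_{n\to \infty}\frac{1}{t_n}\log \mathbb{E} |X_h(t_n)|^p\le \limsup_{n\to \infty}\frac{1}{n} \Bigg[ \sum_{k=0}^{n-1} \frac{1}{h} \log \left( (1+ \Delta A_k)^p + \frac{p}{2}\, \frac{(f^{*})^2 - (3-2p)f_{*}^2}{(1+ \Delta A_k)^{2-p}}\, h + O(h^2) \right)+\sum_{k=0}^{n-1} \frac{p(1-p) f_{*}^2 }{2(1+ \Delta A_k)^2 + p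 \big((f^{*})^2 - (3-2p)f_{*}^2\big) h +2(1+ \Delta A_k)^{2-p} O(h^2)}\Bigg]+O(h)$$ and $$\liminf_{n\to \infty} \frac{1}{t_n}\log \mathbb{E} |X_h(t_n)|^p\ge\liminf_{n\to \infty} \frac{1}{n} \Bigg[ \sum_{k=0}^{n-1} \frac{1}{h} \log \left( (1+ \Delta A_k)^p + \frac{p}{2}\, \frac{f_*^2 - (3-2p)(f^{*})^2}{(1+ \Delta A_k)^{2-p}}\, h + O(h^{3/2}) \frac{1}{(1+\Delta A_k)^{3-p}} \right)+\sum_{k=0}^{n-1} \frac{p(1-p) (1+\Delta A_k) (f^{*})^2 }{2(1+ \Delta A_k)^3 + p (1+\Delta A_k) \big(f_*^2 - (3-2p)(f^{*})^2\big) h + O(h^{3/2})}\Bigg]+O(h).$$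
   Context: $W$ is a standard one-dimensional Brownian motion on a filtered probability space $(\Omega,\mathcal F,\mathbb F,\mathbb P)$. For a step size $h>0$ put $t_n=nh$ ($n=0,1,2,\dots$), $\Delta W_n=W(t_{n+1})-W(t_n)$, $\Delta A_n=\int_{t_n}^{t_{n+1}}a(s)\,ds$. The Milstein scheme for the nonlinear non-autonomous SDE $dX(t)=a(t)X(t)\,dt+f(t,X(t))\,dW(t)$, $X(0)=x_0$, is $X_h(0)=x_0$ and $$X_h(t_{n+1})=X_h(t_n)\left[1+\Delta A_n+\frac{f(t_n,X_h(t_n))}{X_h(t_n)}\Delta W_n+\frac12\,\frac{f(t_n,X_h(t_n))\,\partial_xf(t_n,X_h(t_n))}{X_h(t_n)}\big[(\Delta W_n)^2-h\big]\right].$$ The number $\gamma_*$ depends on $h$; condition (3) is understood for the step sizes $h\in(0,h_0)$ under consideration. Each $O(h^q)$ denotes a deterministic quantity (possibly depending on $k$ when it occurs inside a sum over $k$, and possibly different at each occurrence) bounded in absolute value by $Ch^q$ with $C$ independent of $h$ (for small $h$) and of $n,k$. *)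

(* Defs.v *)
From mathcomp Require Import all_boot all_order all_algebra.
From mathcomp Require Import all_classical all_reals all_analysis.

Set Implicit Arguments.
Unset Strict Implicit.
Unset Printing Implicit Defensive.

Import Order.TTheory GRing.Theory Num.Theory.
Import numFieldNormedType.Exports.

Local Open Scope classical_set_scope.
Local Open Scope ring_scope.

(* Time is the half-line [0, +oo[: values of F and W at negative times are
   unconstrained. *)
Definition filtration d (T : measurableType d) (R : realType)
    (F : R -> set_system T) : Prop :=
  [/\ forall t : R, 0 <= t -> sigma_algebra setT (F t),
      forall t : R, 0 <= t -> F t `<=` measurable &
      forall s t : R, 0 <= s -> s <= t -> F s `<=` F t].

Definition increment (T : Type) (R : realType) (W : R -> T -> R) (s t : R)
    (w : T) : R :=
  W t w - W s w.

(* The second parameter of normal_prob is the standard deviation. *)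
Definition brownian_motion d (T : measurableType d) (R : realType)
    (P : probability T R) (F : R -> set_system T) (W : R -> T -> R) : Prop :=
  [/\ forall (t : R) (B : set R), 0 <= t -> measurable B -> F t (W t @^-1` B),
      {ae P, forall w, W 0 w = 0},
      forall (s t : R) (A : set T) (B : set R), 0 <= s -> s < t ->
        F s A -> measurable B ->
        P (A `&` increment W s t @^-1` B) =
        (P A * P (increment W s t @^-1` B))%E,
      forall (s t : R) (B : set R), 0 <= s -> s < t -> measurable B ->
        P (increment W s t @^-1` B) = normal_prob 0 (Num.sqrt (t - s)) B &
      {ae P, forall w, {within `[0, +oo[, continuous (W ^~ w)}}].

Definition tgrid (R : realType) (h : R) (n : nat) : R := n%:R * h.

Definition incrA (R : realType) (a : R -> R) (h : R) (n : nat) : R :=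
  \int[lebesgue_measure]_(s in `[tgrid h n, tgrid h n.+1]) a s.

Definition incrW (T : Type) (R : realType) (W : R -> T -> R) (h : R) (n : nat)
    (w : T) : R :=
  increment W (tgrid h n) (tgrid h n.+1) w.

Definition inf_incrA (R : realType) (a : R -> R) (h : R) : \bar R :=
  ereal_inf [set (incrA a h k)%:E | k in [set: nat]].

Definition sup_incrA (R : realType) (a : R -> R) (h : R) : \bar R :=
  ereal_sup [set (incrA a h k)%:E | k in [set: nat]].

(* The scheme divides by the current value x; if x = 0, the convention
   y / 0 = 0 plays no role since the bracket is multiplied by x. *)
Fixpoint milstein (T : Type) (R : realType) (x0 : R) (a : R -> R)
    (f : R -> R -> R) (W : R -> T -> R) (h : R) (n : nat) (w : T) : R :=
  if n is m.+1 then
    let t := tgrid h m in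
    let x := milstein x0 a f W h m w in
    x * (1 + incrA a h m + f t x / x * incrW W h m w
         + 2^-1 * (f t x * derive1 (f t) x / x) * (incrW W h m w ^+ 2 - h))
  else x0.

(* Main.v *)
Require Import Defs.
From HB Require Import structures.
From mathcomp Require Import all_boot all_order all_algebra.
From mathcomp Require Import all_classical all_reals all_analysis.
From mathcomp Require Import measurable_realfun ring lra.

Set Implicit Arguments.
Unset Strict Implicit.
Unset Printing Implicit Defensive.

Import Order.TTheory GRing.Theory Num.Theory.
Import numFieldNormedType.Exports.

Local Open Scope classical_set_scope.
Local Open Scope ring_scope.

(** One step of the scheme multiplies the current value by [c * (1 + u)], where
    [c = 1 + incrA a h n] and [u = al * Z + be * (Z ^+ 2 - h)] is a quadratic
    polynomial in the increment [Z] of the Brownian motion, which is centred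
    Gaussian of variance [h] and independent of the past.  Write [phi] for
    [f t x / x] and [r] for [x * derive1 (f t) x / f t x]; then [al = phi / c]
    and [be = phi ^+ 2 * r / (2 * c)].  As [c > 1 / 2] at every step, [al] and
    [be] are bounded uniformly in the step size, the time and the state.

    The third-order Taylor polynomial of [`|1 + u| `^ p] at [0] has an error of
    at most [16 * u ^+ 4] on the whole real line ([powR_taylor3_ub],
    [powR_taylor3_lb]), so it can be integrated against the Gaussian law.
    Since [u] has mean [0] and second moment [al ^+ 2 * h] up to [h ^+ 2],
    while its third and fourth moments are of order [h ^+ 2], this gives

      E `|1 + u| `^ p = 1 - p * (1 - p) / 2 * al ^+ 2 * h + O(h ^+ 2)

    ([expectation_powR_quadratic]).  With [fl / c <= al <= fu / c] and
    conditioning on the past ([integral_milsteinS]), the [p]-th moment of the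
    scheme lies between two products of deterministic one-step factors
    ([milstein_moment_le], [milstein_moment_ge]).

    It remains to compare these factors with the bounds of the theorem.  To
    first order in [h], one step contributes [p * ln c] plus [h / c ^+ 2] times
    a constant to the logarithm.  The constant is [- p * (1 - p) / 2 * fl ^+ 2]
    for the factor bounding the moment from above, and exceeds this value by
    [p / 2 * (fu ^+ 2 - fl ^+ 2)] for the claimed upper bound; for the lower
    bound the roles of [fl] and [fu] are exchanged, and with them the sign of
    the difference.  So both inequalities hold up to [O(h ^+ 2)] per step when
    every remainder inside the sums is taken to be [0]: the errors of order
    [h ^+ 2], divided by the step size, form the final [O(h)], which also
    absorbs the contribution [ln (`|x0| `^ p) / (n * h)] of the initial value. *)

(** * Taylor bounds for powers *)

(** Two applications of the mean value theorem, from [x0] to [x] and then from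
    [x0] to the intermediate point, produce a product of two increments of the
    same sign. *)
Lemma ge0_of_second_derivative (R : realType) (a x0 : R) (g g1 g2 : R -> R) :
  a < x0 -> (forall x, a < x -> is_derive x 1 g (g1 x)) ->
  (forall x, a < x -> is_derive x 1 g1 (g2 x)) ->
  (forall x, a < x -> 0 <= g2 x) ->
  g x0 = 0 -> g1 x0 = 0 -> forall x, a < x -> 0 <= g x.
Proof.
move=> ax0 dg dg1 g2ge0 gx0 g1x0.
have mvt (k dk : R -> R) u v : (forall x, a < x -> is_derive x 1 k (dk x)) ->
    a < u -> u <= v -> exists2 c, u <= c <= v & k v - k u = dk c * (v - u).
  move=> dK au uv.
  have dkuv y : y \in `]u, v[ -> is_derive y 1 k (dk y).
    by rewrite in_itv/= => /andP[uy _]; apply: dK; exact: lt_trans uy.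
  have ck : {within `[u, v], continuous k}.
    apply: derivable_within_continuous => y; rewrite in_itv/= => /andP[uy _].
    by have [] := dK y (lt_le_trans au uy).
  have [c cuv ->] := MVT_segment uv dkuv ck.
  by exists c => //; rewrite in_itv/= in cuv.
move=> x ax; have [x0x|xx0] := leP x0 x.
- have [c /andP[c1 c2]] := mvt g g1 _ _ dg ax0 x0x.
  have [e /andP[e1 e2]] := mvt g1 g2 _ _ dg1 ax0 c1.
  rewrite gx0 g1x0 !subr0 => -> ->.
  by rewrite !mulr_ge0 ?subr_ge0// g2ge0// (lt_le_trans ax0).
- have [c /andP[c1 c2]] := mvt g g1 _ _ dg ax (ltW xx0).
  have ac := lt_le_trans ax c1.
  have [e /andP[e1 e2]] := mvt g1 g2 _ _ dg1 ac c2.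
  rewrite gx0 g1x0 !sub0r => h1 h2; rewrite -[g x]opprK h2 -[g1 c]opprK h1.
  by rewrite mulNr opprK !mulr_ge0 ?subr_ge0// ?g2ge0// ?(lt_le_trans ac)// ltW.
Qed.

Lemma ln_le_sub1 (R : realType) (x : R) : 0 < x -> ln x <= x - 1.
Proof.
by move=> x0; have := @le_ln1Dx _ (x - 1); rewrite addrCA subrr addr0; apply; lra.
Qed.

Lemma powR_neg_tangent (R : realType) (s x : R) : 0 <= s -> 0 < x ->
  1 - s * (x - 1) <= x `^ (- s).
Proof.
move=> s0 x0; rewrite /powR gt_eqF//.
have lnx := ln_le_sub1 x0.
by apply: le_trans (expR_ge1Dx _); nra.
Qed.

(** Concavity of the logarithm at the points [y] and [1]: the tangent line bound
    at [m = 1 + t * (y - 1)] is applied to [y / m] and to [1 / m], with weights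
    [t] and [1 - t]. *)
Lemma powR_bernoulli (R : realType) (t y : R) : 0 <= t <= 1 -> 0 < y ->
  y `^ t <= 1 + t * (y - 1).
Proof.
move=> /andP[t0 t1] y0; set m := 1 + t * (y - 1).
have m0 : 0 < m by rewrite /m; nra.
rewrite -ler_ln ?posrE ?powR_gt0// ln_powR.
have k0 : 0 < m^-1 by rewrite invr_gt0.
have := ln_le_sub1 (mulr_gt0 y0 k0); have := ln_le_sub1 k0.
rewrite lnM ?posrE// lnV ?posrE// => h1 h2.
have e : t * (y * m^-1) + (1 - t) * m^-1 = 1.
  by rewrite mulrA -mulrDl (_ : t * y + (1 - t) = m) ?mulfV ?gt_eqF// /m; ring.
nra.
Qed.

(** With [y = 1 / x], Bernoulli's inequality in the exponent bounds [y `^ s] by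
    the convex combination [(2 - s) * y + (s - 1) * y ^+ 2] of the integral powers,
    whose distance to the tangent line at [x = 1] is explicitly a multiple of
    [(x - 1) ^+ 2]. *)
Lemma powR_neg_quadratic (R : realType) (s x : R) : 1 <= s <= 2 -> 4^-1 < x ->
  x `^ (- s) <= 1 - s * (x - 1) + 24 * (x - 1) ^+ 2.
Proof.
move=> /andP[s1 s2] x4; have x0 : 0 < x by lra.
set y := x^-1; have y0 : 0 < y by rewrite invr_gt0.
have xy : x * y = 1 by rewrite divff// gt_eqF.
have y4 : y <= 4 by nra.
have -> : x `^ (- s) = y * y `^ (s - 1).
  rewrite -{1}(powRr1 (ltW y0)) -powRD; last by apply/implyP => _; rewrite gt_eqF.
  by rewrite addrCA subrr addr0 /y -powR_inv1 ?ltW// -powRrM mulN1r.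
have yb : y `^ (s - 1) <= 1 + (s - 1) * (y - 1).
  by apply: powR_bernoulli => //; lra.
apply: (@le_trans _ _ (y * (1 + (s - 1) * (y - 1)))).
  by rewrite ler_pM2l.
have -> : y * (1 + (s - 1) * (y - 1)) = (2 - s) * y + (s - 1) * y ^+ 2 by ring.
have e1 : y = 1 - (x - 1) + (x - 1) ^+ 2 * y.
  have -> : (x - 1) ^+ 2 * y = x * (x * y) - 2 * (x * y) + y by ring.
  by rewrite xy; ring.
have e2 : y ^+ 2 = 1 - 2 * (x - 1) + (x - 1) ^+ 2 * (2 * y + y ^+ 2).
  have -> : (x - 1) ^+ 2 * (2 * y + y ^+ 2) = 2 * (x * (x * y)) - 4 * (x * y)
    + 2 * y + (x * y) * (x * y) - 2 * y * (x * y) + y ^+ 2 by ring.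
  by rewrite xy; ring.
set q := (x - 1) ^+ 2 in e1 e2 *; have q0 : 0 <= q by exact: sqr_ge0.
have h1 : q * y <= q * 4 by rewrite ler_wpM2l.
have h2 : q * (2 * y + y ^+ 2) <= q * 24 by rewrite ler_wpM2l//; nra.
rewrite e2 {1}e1; nra.
Qed.

Definition powR_taylor3 (R : realType) (p u : R) : R :=
  1 + p * u - p * (1 - p) / 2 * u ^+ 2 + p * (1 - p) * (2 - p) / 6 * u ^+ 3.

Lemma is_derive_taylor3 (R : realType) (p C x : R) : is_derive x 1
  (fun x => powR_taylor3 p (x - 1) + C * (x - 1) ^+ 4)
  (p - p * (1 - p) * (x - 1) + p * (1 - p) * (2 - p) / 2 * (x - 1) ^+ 2
    + 4 * C * (x - 1) ^+ 3).
Proof.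
rewrite /powR_taylor3; apply: is_derive_eq.
by rewrite /GRing.scale/=; field.
Qed.

Lemma is_derive_taylor3' (R : realType) (p C x : R) : is_derive x 1
  (fun x => p - p * (1 - p) * (x - 1) + p * (1 - p) * (2 - p) / 2 * (x - 1) ^+ 2
    + 4 * C * (x - 1) ^+ 3)
  (p * (1 - p) * (- (1 - (2 - p) * (x - 1))) + 12 * C * (x - 1) ^+ 2).
Proof.
apply: is_derive_eq.
by rewrite /GRing.scale/=; field.
Qed.

Lemma is_derive_powR_deriv (R : realType) (p x : R) : 0 < x ->
  is_derive x 1 (fun x => p * x `^ (p - 1)) (- p * (1 - p) * x `^ (- (2 - p))).
Proof.
move=> x0; have h := is_derive1_powR (p - 1) x0.
apply: (is_derive_eq (is_deriveZ p h)).
have -> : - (2 - p) = p - 1 - 1 by ring.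
by rewrite /GRing.scale/=; ring.
Qed.

(** For [u > -1] the second derivative of the error in [x = 1 + u] is at least
    [p * (1 - p)] times the height of [x `^ (p - 2)] above its tangent line at [1].
    For [u <= -1] the left-hand side is at most [- u], and [u ^+ 4] dominates all
    lower powers. *)
Lemma powR_taylor3_ub (R : realType) (p u : R) : 0 < p -> p < 1 ->
  `|1 + u| `^ p <= powR_taylor3 p u + 16 * u ^+ 4.
Proof.
move=> p0 p1; have [u1|u1] := leP u (-1).
  have h1 : `|1 + u| `^ p <= - u.
    rewrite ler0_norm; last by lra.
    apply: (@le_trans _ _ ((- u) `^ p)).
      by apply: ge0_ler_powR; rewrite ?nnegrE; lra.
    have u0 : 0 < - u by lra.
    have p01 : 0 <= p <= 1 by lra.
    by apply: le_trans (powR_bernoulli p01 u0) _; nra.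
  apply: (le_trans h1); rewrite /powR_taylor3.
  set v := - u; have -> : u = - v by rewrite opprK.
  have v1 : 1 <= v by rewrite /v; lra.
  have a1 : p * (1 - p) <= 1 by nra.
  have a0 : 0 <= p * (1 - p) by nra.
  have a2 : p * (1 - p) * (2 - p) <= 2 by nra.
  have a3 : 0 <= p * (1 - p) * (2 - p) by nra.
  have v2 : v <= v ^+ 2 by nra.
  have v3 : v ^+ 2 <= v ^+ 3 by nra.
  have v4 : v ^+ 3 <= v ^+ 4 by nra.
  have k2 : p * (1 - p) / 2 * v ^+ 2 <= v ^+ 4 by nra.
  have k3 : p * (1 - p) * (2 - p) / 6 * v ^+ 3 <= v ^+ 4 by nra.
  have k1 : p * v <= v ^+ 4 by nra.
  have -> : (- v) ^+ 2 = v ^+ 2 by ring.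
  have -> : (- v) ^+ 3 = - v ^+ 3 by ring.
  have -> : (- v) ^+ 4 = v ^+ 4 by ring.
  nra.
rewrite ger0_norm; last by lra.
rewrite -subr_ge0.
pose g (x : R) := powR_taylor3 p (x - 1) + 16 * (x - 1) ^+ 4 - x `^ p.
suff : 0 <= g (1 + u) by rewrite /g (_ : 1 + u - 1 = u)//; ring.
pose g1 (x : R) := (p - p * (1 - p) * (x - 1)
  + p * (1 - p) * (2 - p) / 2 * (x - 1) ^+ 2 + 4 * 16 * (x - 1) ^+ 3)
  - p * x `^ (p - 1).
pose g2 (x : R) := (p * (1 - p) * (- (1 - (2 - p) * (x - 1)))
  + 12 * 16 * (x - 1) ^+ 2) - (- p * (1 - p) * x `^ (- (2 - p))).
have dg (x : R) : 0 < x -> is_derive x 1 g (g1 x).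
  by move=> x0; exact: is_deriveB (is_derive_taylor3 p 16 x) (is_derive1_powR p x0).
have dg1 (x : R) : 0 < x -> is_derive x 1 g1 (g2 x).
  by move=> x0; exact: is_deriveB (is_derive_taylor3' p 16 x) (is_derive_powR_deriv p x0).
have g2ge0 (x : R) : 0 < x -> 0 <= g2 x.
  move=> x0; have p2 : 0 <= 2 - p by lra.
  have a0 : 0 <= p * (1 - p) by nra.
  have := powR_neg_tangent p2 x0; rewrite -subr_ge0 => /(mulr_ge0 a0).
  have := sqr_ge0 (x - 1); rewrite /g2.
  by set X := x `^ _; set Q := (x - 1) ^+ 2; lra.
have g_1 : g 1 = 0 by rewrite /g /powR_taylor3 subrr powR1; ring.
have g1_1 : g1 1 = 0 by rewrite /g1 subrr powR1; ring.
apply: (ge0_of_second_derivative ltr01 dg dg1 g2ge0 g_1 g1_1); lra.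
Qed.

(** For [u > - 1 / 2] the quadratic bound [powR_neg_quadratic] controls the second
    derivative of the error; for smaller [u] the left-hand side is nonpositive,
    its terms of degrees 1 to 3 being negative and [16 * u ^+ 4 >= 1]. *)
Lemma powR_taylor3_lb (R : realType) (p u : R) : 0 < p -> p < 1 ->
  powR_taylor3 p u - 16 * u ^+ 4 <= `|1 + u| `^ p.
Proof.
move=> p0 p1; have [u1|u1] := leP u (- 2^-1).
  apply: le_trans (powR_ge0 _ _).
  rewrite /powR_taylor3.
  set v := - u; have -> : u = - v by rewrite opprK.
  have v1 : 2^-1 <= v by rewrite /v; lra.
  have a0 : 0 <= p * (1 - p) by nra.
  have a3 : 0 <= p * (1 - p) * (2 - p) by nra.
  have v2 : 4^-1 <= v ^+ 2 by nra.
  have v4 : 16^-1 <= v ^+ 4.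
    by rewrite (_ : v ^+ 4 = v ^+ 2 * v ^+ 2); [nra|ring].
  have v3 : 0 <= v ^+ 3 by apply: exprn_ge0; lra.
  have -> : (- v) ^+ 2 = v ^+ 2 by ring.
  have -> : (- v) ^+ 3 = - v ^+ 3 by ring.
  have -> : (- v) ^+ 4 = v ^+ 4 by ring.
  have k2 : 0 <= p * (1 - p) / 2 * v ^+ 2 by nra.
  have k3 : 0 <= p * (1 - p) * (2 - p) / 6 * v ^+ 3 by nra.
  nra.
rewrite ger0_norm; last by lra.
rewrite -subr_ge0.
pose g (x : R) := x `^ p - (powR_taylor3 p (x - 1) + (- 16) * (x - 1) ^+ 4).
suff : 0 <= g (1 + u) by rewrite /g (_ : 1 + u - 1 = u) ?mulNr//; ring.
pose g1 (x : R) := p * x `^ (p - 1) - (p - p * (1 - p) * (x - 1)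
  + p * (1 - p) * (2 - p) / 2 * (x - 1) ^+ 2 + 4 * (- 16) * (x - 1) ^+ 3).
pose g2 (x : R) := - p * (1 - p) * x `^ (- (2 - p)) -
  (p * (1 - p) * (- (1 - (2 - p) * (x - 1))) + 12 * (- 16) * (x - 1) ^+ 2).
have pos (x : R) : 4^-1 < x -> 0 < x by lra.
have dg (x : R) : 4^-1 < x -> is_derive x 1 g (g1 x).
  move=> /pos x0.
  exact: is_deriveB (is_derive1_powR p x0) (is_derive_taylor3 p (- 16) x).
have dg1 (x : R) : 4^-1 < x -> is_derive x 1 g1 (g2 x).
  move=> /pos x0.
  exact: is_deriveB (is_derive_powR_deriv p x0) (is_derive_taylor3' p (- 16) x).
have g2ge0 (x : R) : 4^-1 < x -> 0 <= g2 x.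
  move=> x4; have p12 : 1 <= 2 - p <= 2 by lra.
  have a0 : 0 <= p * (1 - p) by nra.
  have a1 : 0 <= 1 - p * (1 - p) by nra.
  have := mulr_ge0 a1 (sqr_ge0 (x - 1)).
  have := powR_neg_quadratic p12 x4; rewrite -subr_ge0 => /(mulr_ge0 a0).
  have := sqr_ge0 (x - 1); rewrite /g2.
  by set X := x `^ _; set Q := (x - 1) ^+ 2; lra.
have g_1 : g 1 = 0 by rewrite /g /powR_taylor3 subrr powR1; ring.
have g1_1 : g1 1 = 0 by rewrite /g1 subrr powR1; ring.
have lt41 : 4^-1 < 1 :> R by lra.
apply: (ge0_of_second_derivative lt41 dg dg1 g2ge0 g_1 g1_1); lra.
Qed.


(** * Integrals and moments of the normal law *)

Section integral_normal_prob.
Variables (R : realType) (m s : R).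
Local Notation mu := (@lebesgue_measure R).
Local Notation N := (normal_prob m s).
Local Open Scope ereal_scope.

Let mpdf : measurable_fun [set: R] (fun x => (normal_pdf m s x)%:E).
Proof. by apply/measurable_EFinP; exact: measurable_normal_pdf. Qed.

Let pdf_ge0 x : 0 <= (normal_pdf m s x)%:E.
Proof. by rewrite lee_fin normal_pdf_ge0. Qed.

Let integral_normal_indic (E : set R) : measurable E ->
  \int[N]_x (\1_E x)%:E = \int[mu]_x ((\1_E x)%:E * (normal_pdf m s x)%:E).
Proof.
move=> mE; rewrite integral_indic//= setIT /normal_prob integral_mkcond/=.
apply: eq_integral => x _; rewrite patchE indicE.
by case: ifPn => _; rewrite ?mul1e ?mul0e.
Qed.

Import HBNNSimple.

Let integral_normal_nnsfun (f : {nnsfun _ >-> R}) :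
  \int[N]_x (f x)%:E = \int[mu]_x ((f x)%:E * (normal_pdf m s x)%:E).
Proof.
under [LHS]eq_integral do rewrite fimfunE -fsumEFin//.
rewrite [LHS]ge0_integral_fsum//; last 2 first.
  - by move=> r; exact/measurable_EFinP/measurableT_comp.
  - by move=> n x _; rewrite EFinM nnfun_muleindic_ge0.
under [RHS]eq_integral.
  move=> x xD; rewrite fimfunE -fsumEFin// ge0_mule_fsuml; last first.
    by move=> r; rewrite EFinM nnfun_muleindic_ge0.
  over.
rewrite [RHS]ge0_integral_fsum//; last 2 first.
  - move=> r; apply: emeasurable_funM => //.
    by apply/measurable_EFinP; apply/measurableT_comp => //.
  - by move=> n x _; rewrite mule_ge0// EFinM nnfun_muleindic_ge0.
apply: eq_fsbigr => r _.
under [RHS]eq_integral do rewrite EFinM -muleA.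
have mfr : measurable (f @^-1` [set r]) by exact: measurable_funPTI.
rewrite integralZl_indic_nnsfun// integral_normal_indic//.
have [r0|r0] := leP 0%R r.
  rewrite [RHS]ge0_integralZl//.
  - by apply: emeasurable_funM => //; exact/measurable_EFinP/measurable_indic.
  - by move=> x _; rewrite mule_ge0// lee_fin.
rewrite preimage_nnfun0//.
by rewrite !integral0_eq ?mule0// => x _; rewrite indic0 mul0e ?mule0.
Qed.

(** [normal_prob] is the measure with density [normal_pdf]: the identity is the
    definition for indicators, and passes to simple functions and to monotone
    limits. *)
Lemma ge0_integral_normal_prob (f : _ -> \bar R) :
  measurable_fun setT f -> (forall x, 0 <= f x)%E ->
  \int[N]_x f x = \int[mu]_x (f x * (normal_pdf m s x)%:E).
Proof.
move=> mf f0; pose f_ := nnsfun_approx measurableT mf.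
transitivity (lim (\int[N]_x (f_ n x)%:E @[n --> \oo])).
  rewrite -monotone_convergence//=.
  - apply: eq_integral => ? /[!inE] xD; apply/esym/cvg_lim => //=.
    exact: cvg_nnsfun_approx.
  - by move=> n; exact/measurable_EFinP/measurable_funTS.
  - by move=> n ? _; rewrite lee_fin.
  - by move=> x _ a b ab; rewrite lee_fin; exact/lefP/nd_nnsfun_approx.
under eq_fun do rewrite integral_normal_nnsfun.
rewrite -monotone_convergence//=.
- apply: eq_integral => x /[!inE] xD; apply/cvg_lim => //=.
  under eq_fun do rewrite muleC. rewrite muleC.
  by apply: cvgeZl => //; exact: cvg_nnsfun_approx.
- move=> n; apply: emeasurable_funM => //.
  exact/measurable_EFinP/measurable_funTS.
- by move=> n x _; rewrite mule_ge0// lee_fin.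
- move=> x _ a b ab; rewrite lee_wpmul2r// lee_fin.
  exact/lefP/nd_nnsfun_approx.
Qed.

End integral_normal_prob.

(** The fundamental theorem of calculus on the intervals [-n.+1, n.+1], followed by
    dominated convergence. *)
Lemma integral_derivative_eq0 (R : realType) (F f : R -> R) :
  (forall x : R, is_derive x 1 F (f x)) -> continuous f ->
  lebesgue_measure.-integrable [set: R] (EFin \o f) ->
  (fun n : nat => F n.+1%:R - F (- n.+1%:R)) @ \oo --> (0 : R) ->
  (\int[lebesgue_measure]_x (f x)%:E = 0)%E.
Proof.
move=> dF cf intf F0.
pose D (n : nat) : set R := `[- n.+1%:R, n.+1%:R]%classic.
pose f_ (n : nat) : R -> \bar R := (EFin \o f) \_ (D n).
have mf : measurable_fun setT (EFin \o f) by exact: measurable_int intf.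
have mD n : measurable (D n) by exact: measurable_itv.
have intD n : (\int[lebesgue_measure]_x f_ n x =
    (F n.+1%:R - F (- n.+1%:R))%:E)%E.
  rewrite /f_ -integral_mkcond EFinB; apply: continuous_FTC2.
  - by rewrite -subr_gt0 opprK addr_gt0// ltr0n.
  - exact: continuous_subspaceT.
  - have cF x : {for x, continuous F}.
      by apply: differentiable_continuous; apply/derivable1_diffP; case: (dF x).
    split.
    + by move=> x _; case: (dF x).
    + exact/cvg_at_right_filter/cF.
    + exact/cvg_at_left_filter/cF.
  - by move=> x _; rewrite derive1E; case: (dF x).
have : (\int[lebesgue_measure]_x f_ n x)%E @[n --> \oo] -->
    (\int[lebesgue_measure]_x (f x)%:E)%E.
  apply: (@dominated_cvg _ _ _ lebesgue_measure _ measurableT f_ (EFin \o f)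
    (abse \o (EFin \o f))).
  - move=> n; rewrite /f_; apply/(measurable_restrictT _ (mD n)).
    exact: measurable_funTS.
  - move=> x _; apply: cvg_near_cst.
    near=> n; rewrite /f_ patchE mem_set// /D/= in_itv/=.
    rewrite -ler_norml.
    have : `|x| <= n%:R by near: n; exact: nbhs_infty_ger.
    by move=> /le_trans; apply; rewrite ler_nat.
  - by [].
  - by apply/integrable_abse; exact: intf.
  - move=> n x _; rewrite /f_ patchE; case: ifPn => //= _.
    by rewrite normr0 lee_fin.
under eq_fun do rewrite intD.
move/cvg_lim => <- //; apply/cvg_lim => //.
by apply: cvg_EFin; [exact: nearW|exact: F0].
Unshelve. all: by end_near. Qed.

Section gaussian_moments.
Variables (R : realType) (s : R).
Hypothesis s0 : 0 < s.
Local Notation mu := (@lebesgue_measure R).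
Local Notation phi := (normal_pdf 0 s).

Let sn0 : s != 0. Proof. by rewrite gt_eqF. Qed.

(** [`|x| ^+ k <= 1 + (x ^+ 2) ^+ k], and [w ^+ k <= k`! * expR w] at
    [w = e * x ^+ 2]. *)
Lemma monomial_le_expR (k : nat) (e : R) : 0 < e ->
  exists2 C : R, 0 <= C & forall x, `|x| ^+ k <= C * expR (e * x ^+ 2).
Proof.
move=> e0.
have wk (w : R) : 0 <= w -> w ^+ k <= k`!%:R * expR w.
  move=> w0; case: k => [|k].
    by rewrite expr0 fact0 mul1r; apply: le_trans (expR_ge1Dx _); lra.
  have := expR_ge1Dxn k w0; set E := expR w => h.
  have f0 : 0 < (k.+1)`!%:R :> R by rewrite ltr0n fact_gt0.
  rewrite -ler_pdivrMl// mulrC; lra.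
exists (1 + e^-1 ^+ k * k`!%:R).
  by rewrite addr_ge0// mulr_ge0// exprn_ge0// invr_ge0 ltW.
move=> x; have w0 : 0 <= e * x ^+ 2 by rewrite mulr_ge0 ?sqr_ge0// ltW.
have E1 : 1 <= expR (e * x ^+ 2) by apply: le_trans (expR_ge1Dx _); rewrite lerDl.
rewrite mulrDl mul1r -mulrA.
have h2 : x ^+ 2 ^+ k <= e^-1 ^+ k * (k`!%:R * expR (e * x ^+ 2)).
  rewrite (_ : x ^+ 2 ^+ k = e^-1 ^+ k * (e * x ^+ 2) ^+ k).
    by rewrite ler_pM2l ?exprn_gt0 ?invr_gt0//; exact: wk.
  by rewrite -exprMn mulKf// gt_eqF.
have [x1|x1] := leP `|x| 1.
  apply: (@le_trans _ _ 1); first exact: exprn_ile1.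
  by apply: (le_trans E1);
    rewrite lerDl !mulr_ge0 ?exprn_ge0 ?expR_ge0 ?ler0n// invr_ge0 ltW.
apply: (@le_trans _ _ (x ^+ 2 ^+ k)).
  have -> : x ^+ 2 ^+ k = `|x| ^+ k * `|x| ^+ k.
    by rewrite -exprMn -normrM -expr2 ger0_norm ?sqr_ge0.
  by rewrite ler_peMr ?exprn_ge0// exprn_ege1// ltW.
by apply: (le_trans h2); rewrite lerDr expR_ge0.
Qed.

Let normal_pdf0E (r x : R) : r != 0 ->
  normal_pdf 0 r x = normal_peak r * expR (- (x ^+ 2 / (r ^+ 2 *+ 2))).
Proof. by move=> r0; rewrite normal_pdfE// /normal_fun subr0 mulNr. Qed.

(** Doubling the standard deviation leaves a factor [expR (- e * x ^+ 2)] that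
    beats every power; this gives at once the integrability of the monomials and
    their decay at infinity. *)
Lemma monomial_normal_pdf_le (k : nat) :
  exists2 C : R, 0 <= C & forall x, `|x| ^+ k * phi x <= C * normal_pdf 0 (2 * s) x.
Proof.
have e0 : 0 < 3 / (8 * s ^+ 2) by rewrite divr_gt0// mulr_gt0// exprn_gt0.
have [C C0 hC] := monomial_le_expR k e0.
have s20 : 2 * s != 0 by rewrite mulf_neq0.
have pk0 := normal_peak_gt0 sn0.
have pk20 := normal_peak_gt0 s20.
exists (C * normal_peak s / normal_peak (2 * s)).
  by rewrite !mulr_ge0 ?invr_ge0 ?normal_peak_ge0.
move=> x; rewrite !normal_pdf0E//.
have -> : C * normal_peak s / normal_peak (2 * s) *
   (normal_peak (2 * s) * expR (- (x ^+ 2 / ((2 * s) ^+ 2 *+ 2)))) =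
   normal_peak s * (C * expR (- (x ^+ 2 / ((2 * s) ^+ 2 *+ 2)))).
  by field; rewrite gt_eqF.
rewrite mulrCA ler_pM2l//.
have -> : - (x ^+ 2 / ((2 * s) ^+ 2 *+ 2)) =
  3 / (8 * s ^+ 2) * x ^+ 2 + - (x ^+ 2 / (s ^+ 2 *+ 2)) by field.
by rewrite expRD mulrA ler_wpM2r ?expR_ge0.
Qed.

Lemma integrable_monomial_normal_pdf (k : nat) :
  mu.-integrable [set: R] (EFin \o (fun x => x ^+ k * phi x)).
Proof.
have [C C0 hC] := monomial_normal_pdf_le k.
apply: (@le_integrable _ _ _ mu _ measurableT _
   (fun x => C%:E * (normal_pdf 0 (2 * s) x)%:E)%E).
- apply/measurable_EFinP; apply: measurable_funM; first exact: measurable_funX.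
  exact: measurable_normal_pdf.
- move=> x _; rewrite /= lee_fin normrM normrX (ger0_norm (normal_pdf_ge0 _ _ _)).
  by rewrite (le_trans (hC x))// ler_norm.
- by apply: integrableZl => //; exact: integrable_normal_pdf.
Qed.

Lemma is_derive_normal_pdf (x : R) : is_derive x 1 phi (- (x / s ^+ 2 * phi x)).
Proof.
have -> : phi = (fun x => normal_peak s * expR (- (s ^+ 2 *+ 2)^-1 * x ^+ 2)).
  apply/funext => y; rewrite normal_pdf0E//; congr (_ * expR _).
  by rewrite mulNr mulrC.
apply: is_derive_eq.
by rewrite /GRing.scale/=; field.
Qed.

Lemma cvg_monomial_normal_pdf (k : nat) (x : R ^nat) :
  (forall n, `|x n| = n.+1%:R) ->
  (fun n : nat => x n ^+ k * phi (x n)) @ \oo --> (0 : R).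
Proof.
move=> xn; have [C C0 hC] := monomial_normal_pdf_le k.+1.
have s20 : 2 * s != 0 by rewrite mulf_neq0.
pose C' := C * normal_peak (2 * s).
apply: norm_cvg0.
apply: (@squeeze_cvgr _ _ _ _ (cst 0) (fun n => C' * n.+1%:R^-1)).
- apply: nearW => n; rewrite /= normr_ge0/= normrM normrX.
  rewrite (ger0_norm (normal_pdf_ge0 _ _ _)) ler_pdivlMr ?ltr0n//.
  have := hC (x n); rewrite exprS -mulrA {1}xn mulrC => /le_trans; apply.
  by rewrite ler_wpM2l// normal_pdf_ub.
- exact: cvg_cst.
- rewrite -[X in _ --> X](mulr0 C'); apply: cvgM; first exact: cvg_cst.
  exact: cvg_harmonic.
Qed.

(** Stein's identity: the integral of the derivative of [x ^+ k * phi x] vanishes.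
    For [k = 0] the right-hand side is [0], whence the odd moments. *)
Lemma normal_moment_rec (k : nat) :
  (\int[mu]_x (x ^+ k.+1 * phi x)%:E =
   (k%:R * s ^+ 2)%:E * \int[mu]_x (x ^+ k.-1 * phi x)%:E)%E.
Proof.
pose f x := k%:R * (x ^+ k.-1 * phi x) - (s ^+ 2)^-1 * (x ^+ k.+1 * phi x).
have intf1 : mu.-integrable [set: R]
    (fun x => (k%:R)%:E * (x ^+ k.-1 * phi x)%:E)%E.
  by apply: integrableZl => //; exact: integrable_monomial_normal_pdf.
have intf2 : mu.-integrable [set: R]
    (fun x => ((s ^+ 2)^-1)%:E * (x ^+ k.+1 * phi x)%:E)%E.
  by apply: integrableZl => //; exact: integrable_monomial_normal_pdf.
have ff : EFin \o f = (fun x => (k%:R)%:E * (x ^+ k.-1 * phi x)%:E -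
       ((s ^+ 2)^-1)%:E * (x ^+ k.+1 * phi x)%:E)%E by [].
have f0 : (\int[mu]_x (f x)%:E = 0)%E.
  apply: (@integral_derivative_eq0 _ (fun x => x ^+ k * phi x)).
  - move=> x; have dphi := is_derive_normal_pdf x.
    have dX : is_derive x 1 (fun x : R => x ^+ k) (k%:R * x ^+ k.-1).
      apply: DeriveDef; first exact: exprn_derivable.
      by rewrite exp_derive /GRing.scale/= mulr1.
    apply: (is_derive_eq (is_deriveM dX dphi)).
    rewrite /GRing.scale/= /f (exprS x k).
    move: (normal_pdf 0 s x) (x ^+ k) (x ^+ k.-1) (k%:R : R) => u v w z.
    by ring.
  - move=> x; apply: cvgB; apply: cvgM; try exact: cvg_cst.
      by apply: cvgM; [exact: exprn_continuous|exact: continuous_normal_pdf].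
    by apply: cvgM; [exact: exprn_continuous|exact: continuous_normal_pdf].
  - by rewrite ff; exact: integrableB.
  - have h1 := @cvg_monomial_normal_pdf k (fun n => n.+1%:R)
      (fun n => ger0_norm (ler0n _ _)).
    have h2 := @cvg_monomial_normal_pdf k (fun n => - n.+1%:R)
      (fun n => etrans (normrN _) (ger0_norm (ler0n _ _))).
    by have := cvgB h1 h2; rewrite subr0; exact.
move: f0; rewrite (_ : (\int[mu]_x (f x)%:E = \int[mu]_x (EFin \o f) x)%E)// ff.
rewrite integralB//= !integralZl//; try exact: integrable_monomial_normal_pdf.
have /fineK <- := integrable_fin_num measurableT (integrable_monomial_normal_pdf k.-1).
have /fineK <- := integrable_fin_num measurableT (integrable_monomial_normal_pdf k.+1).
rewrite -!EFinM -EFinB => -[/eqP]; rewrite subr_eq0 => /eqP h.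
by congr EFin; rewrite mulrAC h mulrAC mulVf ?mul1r// expf_neq0.
Qed.

Fixpoint normal_moment (k : nat) : R :=
  match k with
  | 0 => 1
  | 1 => 0
  | (k'.+1 as k).+1 => k%:R * s ^+ 2 * normal_moment k'
  end.

Lemma integral_monomial_normal_pdf (k : nat) :
  (\int[mu]_x (x ^+ k * phi x)%:E = (normal_moment k)%:E)%E.
Proof.
have [n] := ubnP k; elim: n k => // n IH [|[|k]] kn.
- by under eq_integral do rewrite expr0 mul1r; exact: integral_normal_pdf.
- by rewrite normal_moment_rec mul0r mul0e.
- by rewrite normal_moment_rec/= IH ?EFinM// -ltnS ltnW.
Qed.

Lemma integral_poly_normal_pdf (n : nat) (a : nat -> R) :
  let q x := \sum_(i < n) a i * x ^+ i in
  mu.-integrable [set: R] (EFin \o (fun x => q x * phi x)) /\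
  (\int[mu]_x (q x * phi x)%:E = (\sum_(i < n) a i * normal_moment i)%:E)%E.
Proof.
move=> q; have qE : EFin \o (fun x => q x * phi x) =
    (fun x => \sum_(i < n) ((a i)%:E * (x ^+ i * phi x)%:E))%E.
  apply/funext => x; rewrite /= /q mulr_suml -sumEFin.
  by apply: eq_bigr => i _; rewrite -EFinM mulrA.
have int_i (i : 'I_n) : mu.-integrable [set: R]
    (fun x => (a i)%:E * (x ^+ i * phi x)%:E)%E.
  by apply: integrableZl => //; exact: integrable_monomial_normal_pdf.
split; first by rewrite qE; exact: integrable_sum.
transitivity (\int[mu]_x (EFin \o (fun x => q x * phi x)%R) x)%E => //.
rewrite qE integral_sum// -sumEFin; apply: eq_bigr => i _.
rewrite integralZl//; last exact: integrable_monomial_normal_pdf.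
by rewrite integral_monomial_normal_pdf.
Qed.

End gaussian_moments.

(** * Fractional moments of a quadratic polynomial of a Gaussian *)

(** Expanding a quartic polynomial in [u] gives a polynomial of degree 8 in [z],
    integrated with the Gaussian moments 1, 0, 1, 0, 3, 0, 15, 0, 105 in units of
    the standard deviation. *)
Lemma integral_quartic_normal_pdf (R : realType) (h al be c0 c1 c2 c3 c4 : R) :
  0 < h ->
  let u z := al * z + be * (z ^+ 2 - h) in
  let q z := c0 + c1 * u z + c2 * u z ^+ 2 + c3 * u z ^+ 3 + c4 * u z ^+ 4 in
  lebesgue_measure.-integrable [set: R]
    (EFin \o (fun z => q z * normal_pdf 0 (Num.sqrt h) z)) /\
  (\int[lebesgue_measure]_z (q z * normal_pdf 0 (Num.sqrt h) z)%:E =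
   (c0 + c2 * (al ^+ 2 * h + 2 * be ^+ 2 * h ^+ 2)
    + c3 * (6 * al ^+ 2 * be * h ^+ 2 + 8 * be ^+ 3 * h ^+ 3)
    + c4 * (3 * al ^+ 4 * h ^+ 2 + 60 * al ^+ 2 * be ^+ 2 * h ^+ 3
            + 60 * be ^+ 4 * h ^+ 4))%:E)%E.
Proof.
move=> h0 u q; have s0 : 0 < Num.sqrt h by rewrite sqrtr_gt0.
(* [u z = b + al * z + be * z ^+ 2] *)
pose b := - (be * h).
pose a := nth 0 [::
  c0 + c1 * b + c2 * b ^+ 2 + c3 * b ^+ 3 + c4 * b ^+ 4;
  c1 * al + c2 * (2 * b * al) + c3 * (3 * b ^+ 2 * al) + c4 * (4 * b ^+ 3 * al);
  c1 * be + c2 * (al ^+ 2 + 2 * b * be)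
    + c3 * (3 * b * al ^+ 2 + 3 * b ^+ 2 * be)
    + c4 * (6 * b ^+ 2 * al ^+ 2 + 4 * b ^+ 3 * be);
  c2 * (2 * al * be) + c3 * (al ^+ 3 + 6 * b * al * be)
    + c4 * (4 * b * al ^+ 3 + 12 * b ^+ 2 * al * be);
  c2 * be ^+ 2 + c3 * (3 * al ^+ 2 * be + 3 * b * be ^+ 2)
    + c4 * (al ^+ 4 + 12 * b * al ^+ 2 * be + 6 * b ^+ 2 * be ^+ 2);
  c3 * (3 * al * be ^+ 2) + c4 * (4 * al ^+ 3 * be + 12 * b * al * be ^+ 2);
  c3 * be ^+ 3 + c4 * (6 * al ^+ 2 * be ^+ 2 + 4 * b * be ^+ 3);
  c4 * (4 * al * be ^+ 3);
  c4 * be ^+ 4].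
have qE : q = fun z => \sum_(i < 9) a i * z ^+ i.
  apply/funext => z; rewrite /q /u !big_ord_recr big_ord0 /= /a/= /b; ring.
rewrite qE; have [iq ->] := integral_poly_normal_pdf s0 9 a; split => //.
congr EFin; rewrite !big_ord_recr big_ord0 /= sqr_sqrtr ?ltW// /a/= /b; ring.
Qed.

(** The Taylor bounds of both signs are quartic in [u]; all terms of their
    integrals beyond [al ^+ 2 * h] carry a factor [h ^+ 2] and have coefficients
    bounded in terms of [A] and [B]. *)
Lemma expectation_powR_quadratic (R : realType) (p A B : R) :
  0 < p -> p < 1 -> 0 <= A -> 0 <= B ->
  exists2 C : R, 0 < C & forall h al be : R, 0 < h -> h <= 1 ->
    0 <= al <= A -> 0 <= be <= B ->
    ((1 - p * (1 - p) / 2 * al ^+ 2 * h - C * h ^+ 2)%:E <=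
      \int[normal_prob 0 (Num.sqrt h)]_z
        (`|1 + (al * z + be * (z ^+ 2 - h))| `^ p)%:E)%E /\
    (\int[normal_prob 0 (Num.sqrt h)]_z
        (`|1 + (al * z + be * (z ^+ 2 - h))| `^ p)%:E <=
      (1 - p * (1 - p) / 2 * al ^+ 2 * h + C * h ^+ 2)%:E)%E.
Proof.
move=> p0 p1 A0 B0.
pose C := 1 + 2 * B ^+ 2 + (6 * A ^+ 2 * B + 8 * B ^+ 3)
  + 16 * (3 * A ^+ 4 + 60 * A ^+ 2 * B ^+ 2 + 60 * B ^+ 4).
have C0 : 0 < C.
  by rewrite /C -!addrA ltr_wpDr ?ltr01// !addr_ge0 ?mulr_ge0 ?addr_ge0
    ?mulr_ge0 ?exprn_ge0.
exists C => // h al be h0 h1 /andP[al0 alA] /andP[be0 beB].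
have mH : measurable_fun [set: R]
    (fun z => `|1 + (al * z + be * (z ^+ 2 - h))| `^ p).
  apply: (@measurableT_comp _ _ _ _ _ _ (@powR R ^~ p)) => //.
  apply: measurableT_comp => //; apply: measurable_funD => //.
  apply: measurable_funD; first exact: measurable_funM.
  by apply: measurable_funM => //; exact: measurable_funB.
rewrite ge0_integral_normal_prob; last 2 first.
- exact/measurable_EFinP.
- by move=> z; rewrite lee_fin powR_ge0.
pose u z := al * z + be * (z ^+ 2 - h).
pose qU z := 1 + p * u z + (- (p * (1 - p) / 2)) * u z ^+ 2
  + (p * (1 - p) * (2 - p) / 6) * u z ^+ 3 + 16 * u z ^+ 4.
pose qL z := 1 + p * u z + (- (p * (1 - p) / 2)) * u z ^+ 2
  + (p * (1 - p) * (2 - p) / 6) * u z ^+ 3 + (- 16) * u z ^+ 4.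
have [iU eU] := integral_quartic_normal_pdf al be 1 p (- (p * (1 - p) / 2))
  (p * (1 - p) * (2 - p) / 6) 16 h0.
have [iL eL] := integral_quartic_normal_pdf al be 1 p (- (p * (1 - p) / 2))
  (p * (1 - p) * (2 - p) / 6) (- 16) h0.
pose H z := `|1 + u z| `^ p * normal_pdf 0 (Num.sqrt h) z.
have HU z : H z <= qU z * normal_pdf 0 (Num.sqrt h) z.
  rewrite ler_wpM2r ?normal_pdf_ge0//.
  by have := powR_taylor3_ub (u z) p0 p1; rewrite /powR_taylor3 /qU mulNr.
have HL z : qL z * normal_pdf 0 (Num.sqrt h) z <= H z.
  rewrite ler_wpM2r ?normal_pdf_ge0//.
  by have := powR_taylor3_lb (u z) p0 p1; rewrite /powR_taylor3 /qL !mulNr.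
have H0 z : 0 <= H z by rewrite mulr_ge0 ?powR_ge0 ?normal_pdf_ge0.
have iH : lebesgue_measure.-integrable [set: R] (EFin \o H).
  apply: (le_integrable measurableT _ _ iU).
  - apply/measurable_EFinP; apply: measurable_funM => //.
    exact: measurable_normal_pdf.
  - move=> z _; rewrite /= lee_fin (ger0_norm (H0 z)).
    exact: le_trans (HU z) (ler_norm _).
have -> : (\int[lebesgue_measure]_x ((`|1 + (al * x + be * (x ^+ 2 - h))| `^ p)%:E
    * (normal_pdf 0 (Num.sqrt h) x)%:E) = \int[lebesgue_measure]_x (EFin \o H) x)%E.
  by apply: eq_integral => z _; rewrite -EFinM.
have k0 : 0 <= p * (1 - p) / 2 by nra.
have k1 : p * (1 - p) / 2 <= 1 by nra.
have t0 : 0 <= p * (1 - p) * (2 - p) / 6 by nra.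
have t1 : p * (1 - p) * (2 - p) / 6 <= 1 by nra.
have hge0 := ltW h0.
have aA : al ^+ 2 <= A ^+ 2 by rewrite ler_pXn2r ?nnegrE.
have aA4 : al ^+ 4 <= A ^+ 4 by rewrite ler_pXn2r ?nnegrE.
have bB2 : be ^+ 2 <= B ^+ 2 by rewrite ler_pXn2r ?nnegrE.
have bB3 : be ^+ 3 <= B ^+ 3 by rewrite ler_pXn2r ?nnegrE.
have bB4 : be ^+ 4 <= B ^+ 4 by rewrite ler_pXn2r ?nnegrE.
have ab : al ^+ 2 * be <= A ^+ 2 * B by rewrite ler_pM ?exprn_ge0.
have ab2 : al ^+ 2 * be ^+ 2 <= A ^+ 2 * B ^+ 2 by rewrite ler_pM ?exprn_ge0.
have h20 : 0 <= h ^+ 2 by exact: sqr_ge0.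
have h3 : h ^+ 3 <= h ^+ 2 by rewrite ler_wiXn2l// ltW.
have h4 : h ^+ 4 <= h ^+ 2 by rewrite ler_wiXn2l// ltW.
have h30 : 0 <= h ^+ 3 by rewrite exprn_ge0// ltW.
have h40 : 0 <= h ^+ 4 by rewrite exprn_ge0// ltW.
have al20 : 0 <= al ^+ 2 by exact: sqr_ge0.
have E3 : 0 <= 6 * al ^+ 2 * be * h ^+ 2 + 8 * be ^+ 3 * h ^+ 3
    <= (6 * A ^+ 2 * B + 8 * B ^+ 3) * h ^+ 2.
  apply/andP; split; first by rewrite addr_ge0 ?mulr_ge0 ?exprn_ge0.
  rewrite [leRHS]mulrDl; apply: lerD.
    by have := ler_wpM2r h20 ab; lra.
  by apply: ler_pM; rewrite ?mulr_ge0 ?exprn_ge0// ler_wpM2l.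
have E4 : 0 <= 3 * al ^+ 4 * h ^+ 2 + 60 * al ^+ 2 * be ^+ 2 * h ^+ 3
      + 60 * be ^+ 4 * h ^+ 4
    <= (3 * A ^+ 4 + 60 * A ^+ 2 * B ^+ 2 + 60 * B ^+ 4) * h ^+ 2.
  apply/andP; split; first by rewrite !addr_ge0 ?mulr_ge0 ?exprn_ge0.
  rewrite [leRHS]mulrDl [X in _ <= X + _]mulrDl.
  apply: lerD; first apply: lerD.
  - by rewrite ler_wpM2r// ler_wpM2l.
  - apply: ler_pM; rewrite ?mulr_ge0 ?exprn_ge0//.
    by lra.
  - by apply: ler_pM; rewrite ?mulr_ge0 ?exprn_ge0// ler_wpM2l.
have E2 : 0 <= 2 * be ^+ 2 * h ^+ 2 <= 2 * B ^+ 2 * h ^+ 2.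
  apply/andP; split; first by rewrite !mulr_ge0 ?exprn_ge0.
  by rewrite ler_wpM2r// ler_wpM2l.
have C2 : C * h ^+ 2 = h ^+ 2 + 2 * B ^+ 2 * h ^+ 2
    + (6 * A ^+ 2 * B + 8 * B ^+ 3) * h ^+ 2
    + 16 * ((3 * A ^+ 4 + 60 * A ^+ 2 * B ^+ 2 + 60 * B ^+ 4) * h ^+ 2).
  by rewrite /C; ring.
move: E2 E3 E4 C2 eU eL; set X2 := 2 * be ^+ 2 * h ^+ 2; set Y2 := 2 * B ^+ 2 * _.
set X3 := 6 * al ^+ 2 * be * _ + _; set Y3 := (6 * A ^+ 2 * B + _) * _.
set X4 := 3 * al ^+ 4 * _ + _ + _; set Y4 := (3 * A ^+ 4 + _ + _) * _.
set ka := p * (1 - p) / 2 in k0 k1 *; set ta := p * (1 - p) * (2 - p) / 6 in t0 t1 *.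
move=> /andP[x20 x2] /andP[x30 x3] /andP[x40 x4] C2 eU eL.
have kx : ka * X2 <= Y2 by apply: le_trans x2; rewrite ler_piMl.
have kx0 : 0 <= ka * X2 by rewrite mulr_ge0.
have tx : ta * X3 <= Y3 by apply: le_trans x3; rewrite ler_piMl.
have tx0 : 0 <= ta * X3 by rewrite mulr_ge0.
split.
- have := le_integral measurableT iL iH (fun z _ => HL z).
  rewrite [X in (X <= _)%E]eL; apply: le_trans; rewrite lee_fin C2.
  lra.
- have := le_integral measurableT iH iU (fun z _ => HU z).
  rewrite [X in (_ <= X)%E]eU => /le_trans; apply; rewrite lee_fin C2.
  lra.
Qed.

(** * Markov property of the Milstein scheme *)

(** [x^-1 = x * (x ^+ 2) `^ (- 1)] also at [x = 0], as the inverse of [0] is [0]. *)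
Lemma measurable_inv (R : realType) : measurable_fun [set: R] (fun x : R => x^-1).
Proof.
rewrite (_ : (fun x : R => x^-1) = (fun x => x * (x ^+ 2) `^ (- 1))).
  apply: measurable_funM => //.
  apply: (@measurableT_comp _ _ _ _ _ _ (@powR R ^~ (- 1))) => //.
apply/funext => x; rewrite powR_inv1 ?sqr_ge0//.
have [->|x0] := eqVneq x 0; first by rewrite invr0 mul0r.
by rewrite expr2 invfM mulrA mulfV// mul1r.
Qed.

Lemma measurable_derive1 (R : realType) (f : R -> R) :
  (forall x : R, derivable f x 1) -> measurable_fun [set: R] (derive1 f).
Proof.
move=> df; have mf : measurable_fun [set: R] f.
  apply: continuous_measurable_fun => x.
  exact/differentiable_continuous/derivable1_diffP.
pose q (n : nat) (x : R) := n.+1%:R * (f (n.+1%:R^-1 + x) - f x).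
apply: (@measurable_fun_cvg _ _ _ _ q).
  move=> n; apply: measurable_funM => //; apply: measurable_funB => //.
  by apply: measurableT_comp => //; exact: measurable_funD.
move=> x _; rewrite derive1E.
have /cvg_ex[l dl] := df x.
have -> : 'D_1 f x = l by apply/cvg_lim.
have u0 : (fun n : nat => n.+1%:R^-1 : R) @ \oo --> 0^'.
  move=> U /= U0; have := @cvg_harmonic R _ U0.
  move=> [N _ hN]; exists N => // n Nn; by apply: (hN n Nn); rewrite invr_neq0 ?pnatr_eq0.
have := cvg_comp _ _ u0 dl.
apply: cvg_trans; apply: near_eq_cvg; apply: nearW => n.
by rewrite /q /= invrK /GRing.scale/= mulr1.
Qed.

Section independence.
Context d d1 d2 (T : measurableType d) (T1 : measurableType d1)
  (T2 : measurableType d2) (R : realType) (P : probability T R).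

(** By independence the joint law of [X] and [Z] is a product measure, to which
    Tonelli's theorem applies. *)
Lemma integral_independent_pair (nu : probability T2 R) (X : T -> T1)
    (Z : T -> T2) (H : T1 * T2 -> \bar R) :
  measurable_fun setT X -> measurable_fun setT Z ->
  (forall A B, measurable A -> measurable B ->
    P (X @^-1` A `&` Z @^-1` B) = (P (X @^-1` A) * nu B)%E) ->
  measurable_fun setT H -> (forall q, 0 <= H q)%E ->
  (\int[P]_w H (X w, Z w) = \int[P]_w (\int[nu]_z H (X w, z)))%E.
Proof.
move=> mX mZ ind mH H0.
have mXZ : measurable_fun setT (fun w => (X w, Z w)) by exact: measurable_fun_pair.
pose X' : {mfun T >-> T1} := HB.pack X (isMeasurableFun.Build _ _ _ _ X mX).
pose XZ : {mfun T >-> (T1 * T2)%type} := HB.pack (fun w => (X w, Z w))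
  (isMeasurableFun.Build _ _ _ _ (fun w => (X w, Z w)) mXZ).
transitivity (\int[distribution P XZ]_q H q)%E.
  by rewrite /distribution ge0_integral_pushforward//= preimage_setT.
transitivity (\int[distribution P X' \x nu]_q H q)%E.
  apply: eq_measure_integral => A mA _; apply/esym.
  apply: (@product_measure_unique _ _ _ _ _ (distribution P X') nu
    (distribution P XZ)) => //.
rewrite fubini_tonelli1// /distribution ge0_integral_pushforward//=.
- exact: measurable_fun_fubini_tonelli_F.
- by move=> x _; exact: integral_ge0.
Qed.

End independence.

Lemma sigma_algebra_preimage_comp2 (T : pointedType) (R : realType)
    (G : set_system T) (X Z : T -> R) (phi : R * R -> R) :
  sigma_algebra setT G ->
  (forall B, measurable B -> G (X @^-1` B)) ->
  (forall B, measurable B -> G (Z @^-1` B)) ->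
  measurable_fun setT phi ->
  forall B, measurable B -> G ((fun w => phi (X w, Z w)) @^-1` B).
Proof.
move=> sG GX GZ mphi.
pose S := g_sigma_algebraType G.
have mG (Y : T -> R) : (forall B, measurable B -> G (Y @^-1` B)) ->
    measurable_fun setT (Y : S -> R).
  by move=> GY _ B mB; rewrite setTI; apply: sub_sigma_algebra; exact: GY.
have mXZ : measurable_fun setT ((fun w => (X w, Z w)) : S -> R * R).
  by apply: measurable_fun_pair; exact: mG.
move=> B mB; rewrite -(sigma_algebra_id sG).
have := @measurableT_comp _ _ _ _ _ _ _ _ _ mphi mXZ measurableT B mB.
by rewrite setTI.
Qed.

(** The update of the scheme, as a function of the pair formed by the current value
    and the increment of the Brownian motion; [g] and [A] are the diffusion
    coefficient and the drift increment at the current time. *)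
Definition milstein_step (R : realType) (g : R -> R) (A h : R) (q : R * R) : R :=
  q.1 * (1 + A + g q.1 / q.1 * q.2
         + 2^-1 * (g q.1 * derive1 g q.1 / q.1) * (q.2 ^+ 2 - h)).

Lemma measurable_milstein_step (R : realType) (g : R -> R) (A h : R) :
  (forall x : R, derivable g x 1) -> measurable_fun setT (milstein_step g A h).
Proof.
move=> dg; have mg : measurable_fun [set: R] g.
  apply: continuous_measurable_fun => x.
  exact/differentiable_continuous/derivable1_diffP.
have m1 (k : R -> R) : measurable_fun [set: R] k ->
    measurable_fun [set: R * R] (fun q => k q.1).
  by move=> mk; apply: (measurableT_comp mk); exact: measurable_fst.
have mi := m1 _ (@measurable_inv R).
have mg1 := m1 _ mg.
have md := m1 _ (measurable_derive1 dg).
have ms : measurable_fun [set: R * R] (fun q : R * R => q.2) by exact: measurable_snd.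
have mf : measurable_fun [set: R * R] (fun q : R * R => q.1) by exact: measurable_fst.
apply: measurable_funM => //; apply: measurable_funD.
  apply: measurable_funD => //; apply: measurable_funM => //.
  exact: measurable_funM.
apply: measurable_funM.
  apply: measurable_funM => //; apply: measurable_funM => //.
  exact: measurable_funM.
by apply: measurable_funB => //; exact: measurable_funX.
Qed.

Section milstein_adapted.
Context d (T : measurableType d) (R : realType) (P : probability T R).
Variables (F : R -> set_system T) (W : R -> T -> R) (x0 : R) (a : R -> R).
Variables (f : R -> R -> R) (h : R).
Hypotheses (hF : filtration F) (hW : brownian_motion P F W).
Hypothesis hf : forall t x : R, derivable (f t) x 1.
Hypothesis h0 : 0 < h.

Let tgrid_ge0 n : 0 <= tgrid h n.
Proof. by rewrite /tgrid mulr_ge0// ltW. Qed.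

Let tgrid_lt n : tgrid h n < tgrid h n.+1.
Proof. by rewrite /tgrid ltr_pM2r// ltr_nat. Qed.

Let tgridB n : tgrid h n.+1 - tgrid h n = h.
Proof. by rewrite /tgrid -mulrBl -natrB// subSnn mul1r. Qed.

Lemma milsteinS n w : milstein x0 a f W h n.+1 w =
  milstein_step (f (tgrid h n)) (incrA a h n) h (milstein x0 a f W h n w, incrW W h n w).
Proof. by []. Qed.

Lemma incrW_adapted n (B : set R) : measurable B ->
  F (tgrid h n.+1) (incrW W h n @^-1` B).
Proof.
have [sF _ monoF] := hF; have [Wad _ _ _ _] := hW.
apply: (@sigma_algebra_preimage_comp2 _ _ (F (tgrid h n.+1)) (W (tgrid h n.+1))
  (W (tgrid h n)) (fun q => q.1 - q.2)).
- exact: sF.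
- by move=> C mC; exact: Wad.
- move=> C mC; apply: (monoF _ _ (tgrid_ge0 n) (ltW (tgrid_lt n))).
  exact: Wad.
- by apply: measurable_funB; [exact: measurable_fst|exact: measurable_snd].
Qed.

Lemma milstein_adapted n (B : set R) : measurable B ->
  F (tgrid h n) (milstein x0 a f W h n @^-1` B).
Proof.
have [sF _ monoF] := hF.
elim: n B => [B mB|n IH].
  have [S0 SC _] := sF _ (tgrid_ge0 0).
  rewrite /=; have [Bx|Bx] := pselect (B x0).
    rewrite (_ : _ @^-1` B = setT); first by rewrite -(setD0 setT); exact: SC.
    by apply/seteqP; split.
  by rewrite (_ : _ @^-1` B = set0)//; apply/seteqP; split.
apply: (@sigma_algebra_preimage_comp2 _ _ (F (tgrid h n.+1)) (milstein x0 a f W h n)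
  (incrW W h n) (milstein_step (f (tgrid h n)) (incrA a h n) h)).
- exact: sF.
- move=> B mB; apply: (monoF _ _ (tgrid_ge0 n) (ltW (tgrid_lt n))).
  exact: IH.
- exact: incrW_adapted.
- exact: measurable_milstein_step.
Qed.

Lemma measurable_milstein n : measurable_fun setT (milstein x0 a f W h n).
Proof.
have [_ subF _] := hF.
move=> _ B mB; rewrite setTI; apply: (subF _ (tgrid_ge0 n)).
exact: milstein_adapted.
Qed.

Lemma measurable_incrW n : measurable_fun setT (incrW W h n).
Proof.
have [_ subF _] := hF.
move=> _ B mB; rewrite setTI; apply: (subF _ (tgrid_ge0 n.+1)).
exact: incrW_adapted.
Qed.

(** Conditioning on the past at time [tgrid h n].  As [H] is arbitrary, this is
    the Markov property of the scheme. *)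
Lemma integral_milsteinS n (H : R -> \bar R) : measurable_fun setT H ->
  (forall x, 0 <= H x)%E ->
  (\int[P]_w H (milstein x0 a f W h n.+1 w) =
   \int[P]_w \int[normal_prob 0 (Num.sqrt h)]_z
      H (milstein_step (f (tgrid h n)) (incrA a h n) h (milstein x0 a f W h n w, z)))%E.
Proof.
move=> mH H0; have [_ _ indep law _] := hW.
have mHs : measurable_fun setT
    (H \o milstein_step (f (tgrid h n)) (incrA a h n) h).
  by apply: measurableT_comp => //; exact: measurable_milstein_step.
have := @integral_independent_pair _ _ _ _ _ _ _ P (normal_prob 0 (Num.sqrt h))
  (milstein x0 a f W h n) (incrW W h n) _ (measurable_milstein n)
  (measurable_incrW n) _ mHs (fun q => H0 _).
under [X in _ -> X = _]eq_integral do rewrite milsteinS.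
apply.
move=> A B mA mB.
have := indep _ _ _ _ (tgrid_ge0 n) (tgrid_lt n) (milstein_adapted n mA) mB.
rewrite /incrW => ->; congr (_ * _)%E.
by have := law _ _ B (tgrid_ge0 n) (tgrid_lt n) mB; rewrite tgridB.
Qed.

End milstein_adapted.

(** * Moment bounds for the scheme *)

Lemma measurable_powR_norm d (T : measurableType d) (R : realType) (p : R)
    (X : T -> R) : measurable_fun setT X ->
  measurable_fun setT (fun w => (`|X w| `^ p)%:E).
Proof.
move=> mX; apply/measurable_EFinP.
apply: (@measurableT_comp _ _ _ _ _ _ (@powR R ^~ p)) => //.
exact: measurableT_comp.
Qed.

(** The hypotheses on [g] bound the coefficients [al = g x / x / c] and
    [be = (g x / x) ^+ 2 * r / (2 * c)] because [c > 1 / 2].  At [x = 0] both bounds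
    and the moment vanish. *)
Lemma milstein_step_moment (R : realType) (p fl fu K : R) :
  0 < p -> p < 1 -> 0 < fl -> 0 < fu -> 0 <= K ->
  exists2 C : R, 0 < C & forall (h A x : R) (g : R -> R), 0 < h -> h <= 1 ->
    - 2^-1 < A ->
    (x != 0 -> fl <= g x / x /\ g x / x <= fu) ->
    (x != 0 -> 2^-1 <= x * derive1 g x / g x /\ x * derive1 g x / g x <= K) ->
    let c := 1 + A in
    ((`|x| `^ p * (c `^ p
        * (1 - p * (1 - p) / 2 * (fu / c) ^+ 2 * h - C * h ^+ 2)))%:E <=
      \int[normal_prob 0 (Num.sqrt h)]_z (`|milstein_step g A h (x, z)| `^ p)%:E)%E
    /\
    (\int[normal_prob 0 (Num.sqrt h)]_z (`|milstein_step g A h (x, z)| `^ p)%:E <=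
      (`|x| `^ p * (c `^ p
        * (1 - p * (1 - p) / 2 * (fl / c) ^+ 2 * h + C * h ^+ 2)))%:E)%E.
Proof.
move=> p0 p1 fl0 fu0 K0.
have A0 : 0 <= 2 * fu by lra.
have B0 : 0 <= fu ^+ 2 * K by rewrite mulr_ge0 ?sqr_ge0.
have [C C0 HC] := expectation_powR_quadratic p0 p1 A0 B0.
exists C => // h A x g h0 h1 hA hg hr c.
have [->|x0] := eqVneq x 0.
  rewrite normr0 powR0 ?gt_eqF// !mul0r.
  under eq_integral do rewrite /milstein_step/= mul0r normr0 powR0 ?gt_eqF//.
  by rewrite integral0.
have [F1 F2] := hg x0; have [r1 r2] := hr x0.
set Fx := g x / x in F1 F2; set r := x * derive1 g x / g x in r1 r2.
have c2 : 2^-1 < c by rewrite /c; lra.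
have c0 : 0 < c by lra.
have Fx0 : 0 < Fx by lra.
have gx0 : g x != 0 by apply: contraTneq Fx0; rewrite /Fx => ->; rewrite mul0r ltxx.
pose al := Fx / c; pose be := Fx ^+ 2 * r / (2 * c).
have stepE z : milstein_step g A h (x, z) =
    x * c * (1 + (al * z + be * (z ^+ 2 - h))).
  rewrite /milstein_step /= /al /be /Fx /r -/c; field.
  by rewrite gx0 x0 gt_eqF.
have al0 : 0 <= al by rewrite divr_ge0// ltW.
have alle : al <= fu / c by rewrite ler_pM2r ?invr_gt0.
have lale : fl / c <= al by rewrite ler_pM2r ?invr_gt0.
have al2 : al <= 2 * fu by rewrite ler_pdivrMr//; nra.
have Fx2 : Fx ^+ 2 <= fu ^+ 2 by rewrite ler_pXn2r ?nnegrE// ltW.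
have r0 : 0 <= r by apply: le_trans r1; lra.
have be0 : 0 <= be.
  by apply: divr_ge0; apply: mulr_ge0 => //; [exact: sqr_ge0|exact: ltW].
have be2 : be <= fu ^+ 2 * K.
  rewrite ler_pdivrMr; last by lra.
  have h3 : Fx ^+ 2 * r <= fu ^+ 2 * K.
    by apply: ler_pM => //; exact: sqr_ge0.
  by apply: (le_trans h3); rewrite ler_peMr//; lra.
have alA : 0 <= al <= 2 * fu by rewrite al0.
have beB : 0 <= be <= fu ^+ 2 * K by rewrite be0.
have [HL HU] := HC h al be h0 h1 alA beB.
set k := `|x| `^ p * c `^ p.
have k0 : 0 <= k by rewrite mulr_ge0 ?powR_ge0.
pose G z := `|1 + (al * z + be * (z ^+ 2 - h))| `^ p.
have mG : measurable_fun [set: R] (EFin \o G).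
  apply: measurable_powR_norm; apply: measurable_funD => //.
  apply: measurable_funD; first exact: measurable_funM.
  by apply: measurable_funM => //; exact: measurable_funB.
have -> : (\int[normal_prob 0 (Num.sqrt h)]_z
    (`|milstein_step g A h (x, z)| `^ p)%:E =
    k%:E * \int[normal_prob 0 (Num.sqrt h)]_z (G z)%:E)%E.
  rewrite -ge0_integralZl//; last by move=> z _; rewrite lee_fin powR_ge0.
  apply: eq_integral => z _; rewrite -EFinM stepE !normrM powRM// powRM//.
  by rewrite (ger0_norm (ltW c0)).
have kap0 : 0 <= p * (1 - p) / 2 by nra.
have kE y : `|x| `^ p * (c `^ p * y) = k * y by rewrite mulrA.
have fule : p * (1 - p) / 2 * al ^+ 2 * h <= p * (1 - p) / 2 * (fu / c) ^+ 2 * h.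
  by rewrite ler_pM2r// ler_wpM2l// ler_pXn2r ?nnegrE// (le_trans al0).
have flle : p * (1 - p) / 2 * (fl / c) ^+ 2 * h <= p * (1 - p) / 2 * al ^+ 2 * h.
  by rewrite ler_pM2r// ler_wpM2l// ler_pXn2r ?nnegrE// divr_ge0// ltW.
rewrite !kE !EFinM; split.
- apply: lee_wpmul2l; first by rewrite lee_fin.
  by apply: le_trans HL; rewrite lee_fin; lra.
- apply: lee_wpmul2l; first by rewrite lee_fin.
  by apply: (le_trans HU); rewrite lee_fin; lra.
Qed.

Section milstein_moments.
Context d (T : measurableType d) (R : realType) (P : probability T R).
Variables (F : R -> set_system T) (W : R -> T -> R) (x0 : R) (a : R -> R).
Variables (f : R -> R -> R) (h p : R) (e : nat -> R).
Hypotheses (hF : filtration F) (hW : brownian_motion P F W).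
Hypothesis hf : forall t x : R, derivable (f t) x 1.
Hypothesis h0 : 0 < h.

Local Notation X := (milstein x0 a f W h).
Local Notation step_moment n x := (\int[normal_prob 0 (Num.sqrt h)]_z
  (`|milstein_step (f (tgrid h n)) (incrA a h n) h (x, z)| `^ p)%:E)%E.

Let mX n : measurable_fun setT (fun w => (`|X n w| `^ p)%:E).
Proof. by apply: measurable_powR_norm; exact: (measurable_milstein _ _ hF hW). Qed.

Let mXk n (k : R) : measurable_fun setT (fun w => (`|X n w| `^ p * k)%:E).
Proof.
apply/measurable_EFinP; apply: measurable_funM => //; apply/measurable_EFinP.
exact: mX.
Qed.

Let mstep n : measurable_fun setT (fun w => step_moment n (X n w)).
Proof.
have mH : measurable_fun setT (fun q =>
    (`|milstein_step (f (tgrid h n)) (incrA a h n) h q| `^ p)%:E).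
  by apply: measurable_powR_norm; exact: measurable_milstein_step.
have := @measurable_fun_fubini_tonelli_F _ _ _ _ _ (normal_prob 0 (Num.sqrt h)) _
  mH (fun q => _).
move=> mfub; apply: (measurableT_comp (mfub _)).
  by move=> q; rewrite lee_fin powR_ge0.
exact: (measurable_milstein _ _ hF hW).
Qed.

Let momentS n : (\int[P]_w (`|X n.+1 w| `^ p)%:E =
  \int[P]_w step_moment n (X n w))%E.
Proof.
apply: (integral_milsteinS x0 a hF hW hf h0 n (H := fun x => (`|x| `^ p)%:E)).
  exact: measurable_powR_norm.
by move=> x; rewrite lee_fin powR_ge0.
Qed.

Let moment0 : (\int[P]_w (`|X 0 w| `^ p)%:E = (`|x0| `^ p)%:E)%E.
Proof.
transitivity (\int[P]_w cst (`|x0| `^ p)%:E w)%E; first exact: eq_integral.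
rewrite integral_cst// -[RHS]mule1; congr (_ * _)%E; exact: probability_setT.
Qed.

Let scale n k : (0 <= k) -> (\int[P]_w (`|X n w| `^ p * k)%:E =
  (\int[P]_w (`|X n w| `^ p)%:E) * k%:E)%E.
Proof.
move=> k0; under eq_integral do rewrite EFinM.
by rewrite ge0_integralZr// => w _; rewrite lee_fin powR_ge0.
Qed.

Lemma milstein_moment_le :
  (forall n x, (step_moment n x <= (`|x| `^ p * expR (e n))%:E)%E) ->
  forall n, (\int[P]_w (`|X n w| `^ p)%:E <=
    (`|x0| `^ p * expR (\sum_(0 <= k < n) e k))%:E)%E.
Proof.
move=> H; elim=> [|n IH]; first by rewrite moment0 big_geq// expR0 mulr1.
rewrite momentS big_nat_recr//= expRD mulrA EFinM.
apply: (@le_trans _ _ (\int[P]_w (`|X n w| `^ p * expR (e n))%:E)%E).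
  apply: ge0_le_integral => //.
  by move=> w _; apply: integral_ge0 => z _; rewrite lee_fin powR_ge0.
by rewrite scale ?expR_ge0// lee_wpmul2r// lee_fin expR_ge0.
Qed.

Lemma milstein_moment_ge :
  (forall n x, ((`|x| `^ p * expR (e n))%:E <= step_moment n x)%E) ->
  forall n, ((`|x0| `^ p * expR (\sum_(0 <= k < n) e k))%:E <=
    \int[P]_w (`|X n w| `^ p)%:E)%E.
Proof.
move=> H; elim=> [|n IH]; first by rewrite moment0 big_geq// expR0 mulr1.
rewrite momentS big_nat_recr//= expRD mulrA EFinM.
apply: (@le_trans _ _ (\int[P]_w (`|X n w| `^ p * expR (e n))%:E)%E); last first.
  by apply: ge0_le_integral.
by rewrite scale ?expR_ge0// lee_wpmul2r// lee_fin expR_ge0.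
Qed.

End milstein_moments.

(** * Comparison of the one-step factors *)

(** Here [1 - a + b] is the bound of the moment factor of one step divided by
    [c `^ p], and [1 + v] the argument of the logarithm in the estimate to be proved,
    divided by [c `^ p]; replacing the exponential by its tangent line leaves
    [v + a >= - a]. *)
Lemma drift_correction_ub (R : realType) (a v b : R) :
  0 <= b -> - 2^-1 <= v -> - (2 * a) <= v ->
  1 - a + b <= (1 + v) * expR (a / (1 + v) + 2 * b).
Proof.
move=> b0 v1 va; have v0 : 0 < 1 + v by lra.
apply: (@le_trans _ _ ((1 + v) * (1 + (a / (1 + v) + 2 * b)))); last first.
  by rewrite ler_pM2l// expR_ge1Dx.
have -> : (1 + v) * (1 + (a / (1 + v) + 2 * b)) = 1 + v + a + 2 * b * (1 + v).
  by field; rewrite gt_eqF.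
nra.
Qed.

(** Counterpart of [drift_correction_ub].  The exponential is now bounded from
    above by [expR t <= (1 - t)^-1], and [e] absorbs the second-order term by which
    [a / (1 + v)] may exceed [a] when [v] is negative. *)
Lemma drift_correction_lb (R : realType) (a v b e : R) :
  0 <= a <= 4^-1 -> 0 <= b <= 3 / 8 -> `|v| <= 2^-1 -> v <= - (2 * a) ->
  2 * a * `|v| <= e ->
  (1 + v) * expR (a / (1 + v) - (e + 4 * b)) <= 1 - a - b.
Proof.
move=> /andP[a0 a1] /andP[b0 b1] v1 va ave.
have v0 : 0 < 1 + v by move: v1; rewrite ler_norml => /andP[]; lra.
set t := a / (1 + v) - (e + 4 * b).
have at1 : a / (1 + v) <= a + e.
  rewrite ler_pdivrMr//.
  have vn : v = - `|v| by rewrite ler0_norm ?opprK//; lra.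
  have n0 := normr_ge0 v.
  move: (`|v|) vn v1 n0 ave => w -> w1 w0 awe.
  have e0 : 0 <= e by apply: le_trans awe; rewrite !mulr_ge0.
  have w2 : 0 <= 2^-1 - w by lra.
  have := mulr_ge0 e0 w2; lra.
have t1 : 1 - a + 4 * b <= 1 - t by rewrite /t; lra.
have t0 : 0 < 1 - t by lra.
have et : expR t <= (1 - t)^-1.
  have := expR_ge1Dx (- t); rewrite expRN => h.
  by rewrite -[expR t]invrK lef_pV2 ?posrE ?invr_gt0 ?expR_gt0.
apply: (@le_trans _ _ ((1 + v) * (1 - t)^-1)); first by rewrite ler_pM2l.
rewrite ler_pdivrMr//.
apply: (@le_trans _ _ ((1 - a - b) * (1 - a + 4 * b))); last first.
  by rewrite ler_wpM2l//; lra.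
nra.
Qed.

Lemma powR_split (R : realType) (c p : R) : 0 < c ->
  c `^ p = c ^+ 2 / c `^ (2 - p).
Proof.
move=> c0; rewrite -powR_mulrn ?ltW// -powRB; last by apply/implyP => _; rewrite gt_eqF.
by congr (_ `^ _); ring.
Qed.

(** The logarithmic term of the upper estimate at a step with [c = 1 + incrA a h k],
    the remainder inside the logarithm being [0]. *)
Definition log_factor_ub (R : realType) (p D h c : R) : R :=
  ln (c `^ p + p / 2 * (D / c `^ (2 - p)) * h + 0).

(** The summand of the second sum of the upper estimate, its remainder being
    [0]. *)
Definition correction_ub (R : realType) (p D q h c : R) : R :=
  (p * (1 - p) * q ^+ 2) / (2 * c ^+ 2 + p * D * h + 2 * c `^ (2 - p) * 0).

(** Both terms of the exponent are functions of [v]: the logarithm is taken of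
    [c `^ p * (1 + v)], and [h] times the correction equals [a / (1 + v)]. *)
Lemma log_step_ub (R : realType) (p D q b h c : R) :
  let a := p * (1 - p) / 2 * (q / c) ^+ 2 * h in
  let v := p / 2 * D / c ^+ 2 * h in
  0 < c -> 0 <= b -> - 2^-1 <= v -> - (2 * a) <= v ->
  c `^ p * (1 - a + b) <=
  expR (log_factor_ub p D h c + h * correction_ub p D q h c + 2 * b).
Proof.
move=> a v c0 b0 v1 va; rewrite /log_factor_ub /correction_ub; have v0 : 0 < 1 + v by lra.
have cp0 : 0 < c `^ p by rewrite powR_gt0.
have cq0 : 0 < c `^ (2 - p) by rewrite powR_gt0.
have cn0 : c != 0 by rewrite gt_eqF.
have -> : c `^ p + p / 2 * (D / c `^ (2 - p)) * h + 0 = c `^ p * (1 + v).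
  by rewrite (powR_split p c0) /v; field; rewrite cn0 gt_eqF.
have den : 2 * c ^+ 2 + p * D * h + 2 * c `^ (2 - p) * 0 = 2 * c ^+ 2 * (1 + v).
  by rewrite /v; field.
have -> : h * ((p * (1 - p) * q ^+ 2)
    / (2 * c ^+ 2 + p * D * h + 2 * c `^ (2 - p) * 0)) = a / (1 + v).
  by rewrite den /a; field; rewrite cn0 gt_eqF.
rewrite -[X in expR X]addrA expRD lnK ?posrE ?mulr_gt0// -mulrA ler_pM2l//.
exact: drift_correction_ub.
Qed.

(** The analogues of [log_factor_ub] and [correction_ub] in the lower estimate,
    whose remainders carry other weights. *)
Definition log_factor_lb (R : realType) (p D h c : R) : R :=
  ln (c `^ p + p / 2 * (D / c `^ (2 - p)) * h + 0 * (1 / c `^ (3 - p))).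

Definition correction_lb (R : realType) (p D q h c : R) : R :=
  (p * (1 - p) * c * q ^+ 2) / (2 * c ^+ 3 + p * c * D * h + 0).

Lemma log_step_lb (R : realType) (p D q b e h c : R) :
  let a := p * (1 - p) / 2 * (q / c) ^+ 2 * h in
  let v := p / 2 * D / c ^+ 2 * h in
  0 < c -> 0 <= a <= 4^-1 -> 0 <= b <= 3 / 8 -> `|v| <= 2^-1 ->
  v <= - (2 * a) -> 2 * a * `|v| <= e ->
  expR (log_factor_lb p D h c + h * correction_lb p D q h c - (e + 4 * b))
  <= c `^ p * (1 - a - b).
Proof.
move=> a v c0 a01 b01 v1 va ave; rewrite /log_factor_lb /correction_lb.
have v0 : 0 < 1 + v by move: v1; rewrite ler_norml => /andP[]; lra.
have cp0 : 0 < c `^ p by rewrite powR_gt0.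
have cq0 : 0 < c `^ (2 - p) by rewrite powR_gt0.
have cn0 : c != 0 by rewrite gt_eqF.
have -> : c `^ p + p / 2 * (D / c `^ (2 - p)) * h + 0 * (1 / c `^ (3 - p))
    = c `^ p * (1 + v).
  by rewrite mul0r (powR_split p c0) /v; field; rewrite cn0 gt_eqF.
have den : 2 * c ^+ 3 + p * c * D * h + 0 = 2 * c ^+ 3 * (1 + v).
  by rewrite /v; field.
have -> : h * ((p * (1 - p) * c * q ^+ 2)
    / (2 * c ^+ 3 + p * c * D * h + 0)) = a / (1 + v).
  by rewrite den /a; field; rewrite cn0 gt_eqF.
rewrite -[X in expR X]addrA expRD lnK ?posrE ?mulr_gt0// -mulrA ler_pM2l//.
exact: drift_correction_lb.
Qed.

(** The inverse of [hs] dominates the sum of the entries, so that finitely many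
    smallness conditions on the step size hold together. *)
Lemma small_step_size (R : realType) (s : seq R) :
  (forall x, x \in s -> 0 <= x) ->
  exists hs : R, [/\ 0 < hs, hs < 1 &
    forall h, 0 < h -> h < hs -> forall x, x \in s -> h * x <= 1].
Proof.
move=> s0; have S0 : 0 <= \sum_(x <- s) x by rewrite big_seq sumr_ge0.
exists (2 + \sum_(x <- s) x)^-1; split.
- by rewrite invr_gt0; lra.
- by rewrite invf_lt1; lra.
move=> h h0 hS x xs; apply: ltW.
have : h * (2 + \sum_(x <- s) x) < 1 by rewrite -ltr_pdivlMr ?div1r//; lra.
apply: le_lt_trans; rewrite ler_pM2l//.
have : x <= \sum_(x <- s) x; last by lra.
rewrite (big_rem x xs)/= lerDl big_seq sumr_ge0// => z zs.
by apply: s0; exact: mem_rem zs.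
Qed.

Lemma invr_sqr_le4 (R : realType) (c : R) : 2^-1 < c -> 0 <= (c ^+ 2)^-1 <= 4.
Proof.
move=> c2; have c0 : 0 < c by lra.
rewrite invr_ge0 sqr_ge0/= -[4]invrK lef_pV2 ?posrE ?exprn_gt0//.
by rewrite expr2; nra.
Qed.

Lemma drift_abs_le (R : realType) (p D h c : R) : 0 < p -> p < 1 -> 0 < h ->
  2^-1 < c -> `|p / 2 * D / c ^+ 2 * h| <= 2 * `|D| * h.
Proof.
move=> p0 p1 h0 c2; have /andP[i0 i4] := invr_sqr_le4 c2.
rewrite !normrM (gtr0_norm h0) ler_pM2r// (ger0_norm i0).
rewrite (gtr0_norm p0) gtr0_norm ?invr_gt0//.
have := ler_wpM2l (normr_ge0 D) i4; have := mulr_ge0 (normr_ge0 D) i0.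
rewrite (_ : p / 2 * `|D| / c ^+ 2 = p / 2 * (`|D| * (c ^+ 2)^-1));
  last by rewrite -mulrA.
set X := `|D| * _ => X0 X4.
by have : p * X <= X; [rewrite ler_piMl// ltW|lra].
Qed.

Section drift.
Variables (R : realType) (p fl fu h c : R).

(** The inequality [- (2 * a) <= v] is where [fl <= fu] enters:
    [v + 2 * a = p / 2 * (fu ^+ 2 - fl ^+ 2) / c ^+ 2 * h]. *)
Lemma drift_ub_conditions : 0 < p -> p < 1 -> 0 < fl -> fl <= fu -> 0 < h ->
  2^-1 < c ->
  let D := fu ^+ 2 - (3 - 2 * p) * fl ^+ 2 in
  let a := p * (1 - p) / 2 * (fl / c) ^+ 2 * h in
  let v := p / 2 * D / c ^+ 2 * h in
  h * (4 * `|D|) <= 1 -> - 2^-1 <= v /\ - (2 * a) <= v.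
Proof.
move=> p0 p1 fl0 flu h0 c2 D a v hD; split.
  have := drift_abs_le D p0 p1 h0 c2; rewrite -/v ler_norml => /andP[+ _].
  by lra.
have /andP[i0 _] := invr_sqr_le4 c2.
have ff : 0 <= fu ^+ 2 - fl ^+ 2.
  by rewrite subr_ge0 ler_pXn2r ?nnegrE// ltW// (lt_le_trans fl0).
have -> : v = p / 2 * (fu ^+ 2 - fl ^+ 2) * (c ^+ 2)^-1 * h - 2 * a.
  by rewrite /v /a /D; field; rewrite gt_eqF//; lra.
by rewrite -[leLHS]add0r lerD2r; do !apply: mulr_ge0 => //; lra.
Qed.

(** As in [drift_ub_conditions] with [fl] and [fu] exchanged, so that now
    [v + 2 * a = p / 2 * (fl ^+ 2 - fu ^+ 2) / c ^+ 2 * h]. *)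
Lemma drift_lb_conditions : 0 < p -> p < 1 -> 0 < fl -> fl <= fu -> 0 < h ->
  2^-1 < c ->
  let D := fl ^+ 2 - (3 - 2 * p) * fu ^+ 2 in
  let a := p * (1 - p) / 2 * (fu / c) ^+ 2 * h in
  let v := p / 2 * D / c ^+ 2 * h in
  h * (4 * `|D|) <= 1 -> h * (8 * fu ^+ 2) <= 1 ->
  [/\ 0 <= a <= 4^-1, `|v| <= 2^-1, v <= - (2 * a) &
      2 * a * `|v| <= 8 * fu ^+ 2 * `|D| * h ^+ 2].
Proof.
move=> p0 p1 fl0 flu h0 c2 D a v hD hfu.
have vD : `|v| <= 2 * `|D| * h by exact: drift_abs_le.
have /andP[i0 i4] := invr_sqr_le4 c2.
have fu20 : 0 <= fu ^+ 2 by exact: sqr_ge0.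
have a0 : 0 <= a.
  by apply: mulr_ge0; [apply: mulr_ge0; [nra|exact: sqr_ge0]|exact: ltW].
have a2 : a <= 2 * fu ^+ 2 * h.
  rewrite /a expr_div_n ler_pM2r//.
  have := ler_wpM2l fu20 i4; have := mulr_ge0 fu20 i0.
  set X := fu ^+ 2 * _ => X0 X4.
  have p2 : p * (1 - p) / 2 <= 2^-1 by nra.
  by have := ler_wpM2r X0 p2; lra.
split.
- by rewrite a0/=; lra.
- by lra.
- have ff : 0 <= fu ^+ 2 - fl ^+ 2.
    by rewrite subr_ge0 ler_pXn2r ?nnegrE// ltW// (lt_le_trans fl0).
  have -> : v = - (2 * a) - p / 2 * (fu ^+ 2 - fl ^+ 2) * (c ^+ 2)^-1 * h.
    by rewrite /v /a /D; field; rewrite gt_eqF//; lra.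
  by rewrite gerBl; do !apply: mulr_ge0 => //; lra.
- by have := ler_pM a0 (normr_ge0 v) a2 vD; lra.
Qed.

End drift.

(** * Lyapunov exponents *)

Lemma near_le_limn_esup (R : realType) (u v : (\bar R)^nat) (r : R) :
  (\forall n \near \oo, u n <= v n + r%:E)%E ->
  (limn_esup u <= limn_esup v + r%:E)%E.
Proof.
move=> uv; rewrite -leeBlDr//; apply: le_ereal_inf_tmp => _ [V FV <-].
pose V' := V `&` [set n | (u n <= v n + r%:E)%E].
rewrite leeBlDr//; apply: (@le_trans _ _ (ereal_sup (u @` V'))).
  by apply: ereal_inf_lbound; exists V' => //; exact: filterI.
apply: ge_ereal_sup => _ [n [Vn /= uvn] <-]; apply: (le_trans uvn).
by rewrite leeD2r//; apply: ereal_sup_ubound; exists n.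
Qed.

Lemma near_le_limn_einf (R : realType) (u v : (\bar R)^nat) (r : R) :
  (\forall n \near \oo, v n + r%:E <= u n)%E ->
  (limn_einf v + r%:E <= limn_einf u)%E.
Proof.
move=> uv; rewrite /limn_einf -[r]opprK EFinN -oppeD ?fin_num_adde_defl//.
rewrite leeN2; apply: near_le_limn_esup; apply: filterS uv => n /=.
by rewrite -leeN2 oppeD ?fin_num_adde_defl.
Qed.


Section lyapunov.
Variables (R : realType) (M : nat -> \bar R) (l t : nat -> R) (y b h : R).
Hypotheses (h0 : 0 < h) (y0 : 0 < y).

Let S n : R := n%:R^-1 *
  (\sum_(0 <= k < n) h^-1 * l k + \sum_(0 <= k < n) t k).

Let exponentE n (d : R) : (0 < n)%N ->
  (tgrid h n)^-1 * (ln y + \sum_(0 <= k < n) (l k + h * t k + d)) =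
  S n + d / h + (tgrid h n)^-1 * ln y.
Proof.
move=> n0; rewrite !big_split/= -!mulr_sumr sumr_const_nat subn0 -mulr_natr.
rewrite /S -mulr_sumr /tgrid; field.
by rewrite gt_eqF// pnatr_eq0 -lt0n.
Qed.

(** The initial value contributes [ln y / (n * h)], which is at most [h] for large
    [n]. *)
Let near_large : \forall n \near \oo, (0 < n)%N /\ `|(tgrid h n)^-1 * ln y| <= h.
Proof.
near=> n; have n0 : (0 < n)%N by near: n; exact: nbhs_infty_gt.
split => //; have tn : 0 < tgrid h n by rewrite /tgrid mulr_gt0// ltr0n.
rewrite normrM gtr0_norm ?invr_gt0// mulrC ler_pdivrMr// /tgrid mulrCA.
rewrite -ler_pdivrMr ?mulr_gt0//.
by near: n; exact: nbhs_infty_ger.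
Unshelve. all: by end_near. Qed.

Let lne_expR s : lne (y * expR s)%:E = (ln y + s)%:E.
Proof. by rewrite lne_EFin ?mulr_gt0 ?expR_gt0// lnM ?posrE ?expR_gt0// expRK. Qed.

Lemma near_lyapunov_le :
  (forall n, 0 <= M n)%E ->
  (forall n, M n <= (y * expR (\sum_(0 <= k < n) (l k + h * t k + b)))%:E)%E ->
  (\forall n \near \oo, ((tgrid h n)^-1)%:E * lne (M n)
     <= (S n)%:E + (b / h + h)%:E)%E.
Proof.
move=> M0 MU; apply: filterS near_large => n [n0 hn].
have tn : 0 < tgrid h n by rewrite /tgrid mulr_gt0// ltr0n.
apply: (@le_trans _ _ (((tgrid h n)^-1)%:E *
    (ln y + \sum_(0 <= k < n) (l k + h * t k + b))%:E)%E).
  apply: lee_wpmul2l; first by rewrite lee_fin invr_ge0 ltW.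
  rewrite -lne_expR lee_lne// in_itv/= leey ?M0//.
  by rewrite lee_fin mulr_ge0 ?expR_ge0 ?ltW.
rewrite -EFinM -EFinD lee_fin exponentE// addrA lerD2l.
exact: le_trans (ler_norm _) hn.
Qed.

Lemma near_lyapunov_ge :
  (forall n, 0 <= M n)%E ->
  (forall n, (y * expR (\sum_(0 <= k < n) (l k + h * t k - b)))%:E <= M n)%E ->
  (\forall n \near \oo, (S n)%:E + (- (b / h + h))%:E
     <= ((tgrid h n)^-1)%:E * lne (M n))%E.
Proof.
move=> M0 ML; apply: filterS near_large => n [n0 hn].
have tn : 0 < tgrid h n by rewrite /tgrid mulr_gt0// ltr0n.
apply: (@le_trans _ _ (((tgrid h n)^-1)%:E *
    (ln y + \sum_(0 <= k < n) (l k + h * t k - b))%:E)%E); last first.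
  apply: lee_wpmul2l; first by rewrite lee_fin invr_ge0 ltW.
  rewrite -lne_expR lee_lne// in_itv/= leey ?M0//.
  by rewrite lee_fin mulr_ge0 ?expR_ge0 ?ltW.
rewrite -EFinM -EFinD lee_fin exponentE// mulNr opprD addrA lerD2l.
by move: hn; rewrite ler_norml => /andP[].
Qed.

End lyapunov.

(** * The Lyapunov exponent of the Milstein scheme *)

Theorem theorem1p4 (d : measure_display) (T : measurableType d) (R : realType)
    (P : probability T R) (F : R -> set_system T) (W : R -> T -> R)
    (x0 : R) (a : R -> R) (f : R -> R -> R) (h0 fl fu : R)
    (hF : filtration F) (hW : brownian_motion P F W)
    (hx0 : x0 != 0)
    (ha : forall t : R, 0 < t ->
       lebesgue_measure.-integrable `[0, t] (EFin \o a))
    (hf : forall t x : R, derivable (f t) x 1)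
    (h1 : limf_esup
            (fun t : R => (t^-1 * \int[lebesgue_measure]_(s in `[0, t]) a s)%:E)
            (pinfty_nbhs R) \is a fin_num)
    (hh0 : 0 < h0)
    (h2 : forall h : R, 0 < h -> h < h0 ->
       ((- 2^-1)%:E < inf_incrA a h)%E /\ (sup_incrA a h < +oo)%E)
    (hfl : 0 < fl) (hfu : 0 < fu)
    (h3 : forall t x : R, x != 0 -> fl <= f t x / x /\ f t x / x <= fu)
    (h3' : forall h : R, 0 < h -> h < h0 -> forall t x : R, x != 0 ->
       Num.max 2^-1 (2 / (3 + 2 * fine (inf_incrA a h)))
         <= x * derive1 (f t) x / f t x)
    (h3'' : exists K : R, forall t x : R, x != 0 ->
       x * derive1 (f t) x / f t x <= K)
    (p : R) (hp0 : 0 < p) (hp1 : p < 1) :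
  exists hs C : R, [/\ 0 < hs, hs < 1, 0 < C &
    forall h : R, 0 < h -> h < hs ->
      let c := fun k => 1 + incrA a h k in
      let lyap := fun n : nat =>
        (((tgrid h n)^-1)%:E
          * lne ('E_P[fun w => (`|milstein x0 a f W h n w| `^ p)%R]))%E in
      (exists (r1 r2 : nat -> R) (r3 : R),
        [/\ forall k, `|r1 k| <= C * h ^+ 2,
            forall k, `|r2 k| <= C * h ^+ 2,
            `|r3| <= C * h &
            (limn_esup lyap <=
              limn_esup (fun n : nat => (n%:R^-1 *
                (\sum_(0 <= k < n) h^-1 *
                   ln (c k `^ p
                       + p / 2 * ((fu ^+ 2 - (3 - 2 * p) * fl ^+ 2)
                                  / c k `^ (2 - p)) * h
                       + r1 k)
                 + \sum_(0 <= k < n)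
                   (p * (1 - p) * fl ^+ 2)
                   / (2 * c k ^+ 2
                      + p * (fu ^+ 2 - (3 - 2 * p) * fl ^+ 2) * h
                      + 2 * c k `^ (2 - p) * r2 k)))%:E)
              + r3%:E)%E]) /\
      (exists (r1 r2 : nat -> R) (r3 : R),
        [/\ forall k, `|r1 k| <= C * h `^ (3 / 2),
            forall k, `|r2 k| <= C * h `^ (3 / 2),
            `|r3| <= C * h &
            (limn_einf (fun n : nat => (n%:R^-1 *
                (\sum_(0 <= k < n) h^-1 *
                   ln (c k `^ p
                       + p / 2 * ((fl ^+ 2 - (3 - 2 * p) * fu ^+ 2)
                                  / c k `^ (2 - p)) * h
                       + r1 k * (1 / c k `^ (3 - p)))
                 + \sum_(0 <= k < n)
                   (p * (1 - p) * c k * fu ^+ 2)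
                   / (2 * c k ^+ 3
                      + p * c k * (fl ^+ 2 - (3 - 2 * p) * fu ^+ 2) * h
                      + r2 k)))%:E)
              + r3%:E <= limn_einf lyap)%E])].
Proof.
have fl_fu : fl <= fu.
  by have [lo hi] := h3 0 1 (oner_neq0 R); exact: le_trans hi.
have [K r_ub] := h3''.
have r_lb t x : x != 0 -> 2^-1 <= x * derive1 (f t) x / f t x.
  (* The step size [h0 / 2] stands for any admissible one. *)
  move=> xn0; have hhalf : 0 < h0 / 2 by rewrite divr_gt0.
  have hlt : h0 / 2 < h0 by rewrite gtr_pMr// invf_lt1// ltr1n.
  by have := h3' _ hhalf hlt t x xn0; rewrite ge_max => /andP[].
have K0 : 0 <= K.
  have := le_trans (r_lb 0 1 (oner_neq0 R)) (r_ub 0 1 (oner_neq0 R)).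
  by apply: le_trans; rewrite invr_ge0.
have [C C0 step_bounds] := milstein_step_moment hp0 hp1 hfl hfu K0.
pose DU := fu ^+ 2 - (3 - 2 * p) * fl ^+ 2.
pose DL := fl ^+ 2 - (3 - 2 * p) * fu ^+ 2.
(* [E * h ^+ 2] bounds the product [2 * a * `|v|] of [log_step_lb]. *)
pose E := 8 * fu ^+ 2 * `|DL|.
have E0 : 0 <= E by apply: mulr_ge0 => //; apply: mulr_ge0 => //; exact: sqr_ge0.
(* The entries are chosen to give, in this order, [h <= 1], [h <= h0 / 2], the
   smallness of the terms [v] and [a], and [C * h ^+ 2 <= 3 / 8]. *)
have [x|hs [hs0 hs1 small]] := @small_step_size R
    [:: 1; 2 / h0; 4 * `|DU|; 4 * `|DL|; 8 * fu ^+ 2; 3 * C].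
  rewrite !inE => /or4P[/eqP->|/eqP->|/eqP->|/or3P[/eqP->|/eqP->|/eqP->]];
    by rewrite ?divr_ge0 ?mulr_ge0 ?sqr_ge0// ltW.
exists hs, ((2 * C + 1) + (E + 4 * C + 1)); split => //.
  by clear -C0 E0; lra.
move=> h hgt0 hlt c lyap.
have [q0 q1 q2] : [/\ h * 1 <= 1, h * (2 / h0) <= 1 & h * (4 * `|DU|) <= 1].
  by split; apply: small hgt0 hlt _ _; rewrite !inE eqxx ?orbT.
have [q3 q4 q5] : [/\ h * (4 * `|DL|) <= 1, h * (8 * fu ^+ 2) <= 1
    & h * (3 * C) <= 1].
  by split; apply: small hgt0 hlt _ _; rewrite !inE eqxx ?orbT.
rewrite mulr1 in q0.
have hlth0 : h < h0.
  by move: q1; rewrite mulrA ler_pdivrMr// mul1r; apply: lt_le_trans;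
    rewrite ltr_pMr// ltr1n.
have A_lb k : - 2^-1 < incrA a h k.
  rewrite -lte_fin; have [/lt_le_trans + _] := h2 h hgt0 hlth0; apply.
  by apply: ereal_inf_lbound; exists k.
have c_lb k : 2^-1 < c k by rewrite /c -ltrBlDl; apply: le_lt_trans (A_lb k); lra.
have c_gt0 k : 0 < c k by apply: lt_trans (c_lb k); rewrite invr_gt0.
have b0 : 0 <= C * h ^+ 2 by rewrite mulr_ge0 ?sqr_ge0// ltW.
have b1 : C * h ^+ 2 <= 3 / 8.
  apply: (@le_trans _ _ (C * h)).
    by rewrite ler_pM2l// expr2 ler_piMr// ltW.
  by move: q5; clear -C0 hgt0; lra.
have ub k := drift_ub_conditions hp0 hp1 hfl fl_fu hgt0 (c_lb k) q2.
have lb k := drift_lb_conditions hp0 hp1 hfl fl_fu hgt0 (c_lb k) q3 q4.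
have steps k x := step_bounds h (incrA a h k) x (f (tgrid h k)) hgt0 q0 (A_lb k)
  (h3 (tgrid h k) x)
  (fun xn0 => conj (r_lb (tgrid h k) x xn0) (r_ub (tgrid h k) x xn0)).
have step_ub k x : (\int[normal_prob 0 (Num.sqrt h)]_z
    (`|milstein_step (f (tgrid h k)) (incrA a h k) h (x, z)| `^ p)%:E <=
    (`|x| `^ p * expR (log_factor_ub p DU h (c k)
       + h * correction_ub p DU fl h (c k) + 2 * (C * h ^+ 2)))%:E)%E.
  have [_ /le_trans] := steps k x; apply.
  rewrite lee_fin ler_wpM2l ?powR_ge0//.
  by have [v1 v2] := ub k; exact: (log_step_ub (c_gt0 k) b0 v1 v2).
have step_lb k x : ((`|x| `^ p * expR (log_factor_lb p DL h (c k)
       + h * correction_lb p DL fu h (c k) - (E * h ^+ 2 + 4 * (C * h ^+ 2))))%:E <=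
    \int[normal_prob 0 (Num.sqrt h)]_z
    (`|milstein_step (f (tgrid h k)) (incrA a h k) h (x, z)| `^ p)%:E)%E.
  have [low _] := steps k x; apply: le_trans low.
  rewrite lee_fin ler_wpM2l ?powR_ge0//.
  have [a4 v1 v2 av] := lb k.
  have b01 : 0 <= C * h ^+ 2 <= 3 / 8 by rewrite b0.
  exact: (log_step_lb (c_gt0 k) a4 b01 v1 v2 av).
have moment_ub := milstein_moment_le x0 hF hW hf hgt0 step_ub.
have moment_lb := milstein_moment_ge x0 hF hW hf hgt0 step_lb.
have y0 : 0 < `|x0| `^ p by rewrite powR_gt0// normr_gt0.
have M0 n : (0 <= 'E_P[fun w => (`|milstein x0 a f W h n w| `^ p)%R])%E.
  by apply: expectation_ge0 => w; exact: powR_ge0.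
have CC0 : 0 <= (2 * C + 1) + (E + 4 * C + 1) by clear -C0 E0; lra.
(* The last remainder collects the errors of order [h ^+ 2] of the steps, divided
   by [h], and an extra [h] for the initial value. *)
split; exists (fun=> 0), (fun=> 0).
- exists ((2 * (C * h ^+ 2)) / h + h); split.
  + by move=> k; rewrite normr0 mulr_ge0 ?sqr_ge0.
  + by move=> k; rewrite normr0 mulr_ge0 ?sqr_ge0.
  + have -> : (2 * (C * h ^+ 2)) / h + h = (2 * C + 1) * h.
      by clear -hgt0; field; rewrite gt_eqF.
    rewrite ger0_norm; last by rewrite mulr_ge0 ?ltW//; clear -C0; lra.
    by rewrite ler_pM2r//; clear -C0 E0; lra.
  + apply: near_le_limn_esup.
    apply: (near_lyapunov_le (l := fun k => log_factor_ub p DU h (c k))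
      (t := fun k => correction_ub p DU fl h (c k)) hgt0 y0 M0) => n.
    by rewrite expectation.unlock; exact: moment_ub.
- exists (- ((E * h ^+ 2 + 4 * (C * h ^+ 2)) / h + h)); split.
  + by move=> k; rewrite normr0 mulr_ge0 ?powR_ge0.
  + by move=> k; rewrite normr0 mulr_ge0 ?powR_ge0.
  + have -> : (E * h ^+ 2 + 4 * (C * h ^+ 2)) / h + h = (E + 4 * C + 1) * h.
      by clear -hgt0; field; rewrite gt_eqF.
    rewrite normrN ger0_norm; last by rewrite mulr_ge0 ?ltW//; clear -C0 E0; lra.
    by rewrite ler_pM2r//; clear -C0 E0; lra.
  + apply: near_le_limn_einf.
    apply: (near_lyapunov_ge (l := fun k => log_factor_lb p DL h (c k))
      (t := fun k => correction_lb p DL fu h (c k)) hgt0 y0 M0) => n.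
    by rewrite expectation.unlock; exact: moment_lb.
Qed.
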